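(* For every $\beta\in(0,1)$ the function $\mathfrak e\mapsto \rho_{\beta,\mathfrak e}$, $\mathfrak e\in[0,1)$, is non-decreasing, where $\rho_{\beta,\mathfrak e}$ denotes the (transverse) rotation number of the Euler orbit. Moreover, $$\rho_{\beta,\mathfrak e}>\rho_{\beta,0}=1+\sqrt{1+7\beta},\qquad \forall(\beta,\mathfrak e)\in(0,1)\times(0,1).$$
   Context: The spatial isosceles three-body problem in reduced form is the Hamiltonian system of $$H(p_r,p_z,r,z)=\frac{p_r^2+p_z^2}{2}+\frac{\varpi^2}{2r^2}-\frac1r-\frac{4}{\alpha\sqrt{r^2+(1+2\alpha)z^2}},\quad (r,z)\in(0,\infty)\times\mathbb R,\ (p_r,p_z)\in\mathbb R^2,$$ with $\alpha,\varpi>0$, on the energy level $H=-1$. Put $\beta=1/(1+4/\alpha)\in(0,1)$ and $\mathfrak e=\sqrt{1-2\varpi^2\beta^2}$; the parameters $(\beta,\mathfrak e)$ determine $(\alpha,\varpi)$. The Euler orbit is the periodic orbit $\zeta_e=H^{-1}(-1)\cap\{z=p_z=0\}$. Its rotation number $\rho_{\beta,\mathfrak e}$ (transverse linearized flow, measured in a global trivialization) is given, for $(\beta,\mathfrak e)\in(0,1)\times[0,1)$, by $$\rho_{\beta,\mathfrak e}=\rho(\gamma_{\beta,\mathfrak e})+1 ,$$ where $\gamma_{\beta,\mathfrak e}:\mathbb R\to \mathrm{Sp}(2)$, $\gamma_{\beta,\mathfrak e}(0)=I_2$, is the fundamental solution of $$\xi'(\theta)=\begin{pmatrix}0&-1\\1&0\end{pmatrix}\begin{pmatrix}1&0\\0&1+\frac{7\beta}{1+\mathfrak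 e\cos\theta}\end{pmatrix}\xi(\theta)$$ (the first-order form of the Hill equation $\ddot x=-\left(1+\frac{7\beta}{1+\mathfrak e\cos\theta}\right)x$), and $\rho(\gamma_{\beta,\mathfrak e})=\lim_{k\to\infty}\frac{\eta_v(2\pi k)}{2\pi k}$, with $\eta_v(\theta)$ a continuous argument of $\gamma_{\beta,\mathfrak e}(\theta)v\in\mathbb R^2\cong\mathbb C$ for any $v\neq0$ (the limit does not depend on $v$). *)

(* Defs.v *)
From Stdlib Require Import Reals.
From Coquelicot Require Import Coquelicot.
Open Scope R_scope.

Definition mat2 : Type := @matrix R 2 2.

Definition mk_mat2 (a b c d : R) : mat2 := ((a, (b, tt)), ((c, (d, tt)), tt)).

Definition entry (g : mat2) (i j : nat) : R := coeff_mat 0 g i j.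

Definition J2 : mat2 := mk_mat2 0 (-1) 1 0.

Definition hill_coefficient (beta e theta : R) : R :=
  1 + 7 * beta / (1 + e * cos theta).

(* Coquelicot puts no norm on [matrix], so the derivative is taken entrywise.
   The values lie in Sp(2) automatically: the coefficient matrix has trace 0. *)
Definition is_fundamental_solution (beta e : R) (gamma : R -> mat2) : Prop :=
  gamma 0 = Mone /\
  forall (theta : R) (i j : nat), (i < 2)%nat -> (j < 2)%nat ->
    is_derive (fun t => entry (gamma t) i j) theta
      (entry (Mmult (Mmult J2 (mk_mat2 1 0 0 (hill_coefficient beta e theta)))
                    (gamma theta)) i j).

(* Matrix times column vector, with R^2 identified with C. *)
Definition mat2_act (g : mat2) (v : C) : C :=
  (entry g 0 0 * fst v + entry g 0 1 * snd v,
   entry g 1 0 * fst v + entry g 1 1 * snd v).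

Definition is_continuous_argument (w : R -> C) (eta : R -> R) : Prop :=
  (forall theta : R, continuous eta theta) /\
  (forall theta : R,
     w theta = Cmult (RtoC (Cmod (w theta))) (cos (eta theta), sin (eta theta))).

(* Two continuous arguments of the same nowhere vanishing curve differ by a
   constant, which does not affect the limit; hence [exists eta].  The term
   k = 0, a division by zero, is irrelevant. *)
Definition is_path_rotation_number (gamma : R -> mat2) (rho : R) : Prop :=
  forall v : C, v <> RtoC 0 ->
    exists eta : R -> R,
      is_continuous_argument (fun theta => mat2_act (gamma theta) v) eta /\
      is_lim_seq (fun k : nat => eta (2 * PI * INR k) / (2 * PI * INR k)) rho.

Definition is_euler_rotation_number (beta e rho : R) : Prop :=
  exists gamma : R -> mat2,
    is_fundamental_solution beta e gamma /\
    exists r : R, is_path_rotation_number gamma r /\ rho = r + 1.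

(* The Euler orbit lies at z = p_z = 0 on the energy level -1 of the reduced
   spatial isosceles three-body problem with parameters (alpha, varpi), where
   beta = 1 / (1 + 4 / alpha) and e = sqrt (1 - 2 varpi^2 beta^2).  The angle
   theta is the true anomaly along the orbit, and the summand 1 in
   [is_euler_rotation_number] comes from measuring the transverse linearized
   flow in a global trivialization.

   [iota] is definite description: the value is meaningful where exactly one
   real satisfies the predicate. *)
Definition euler_rotation_number (beta e : R) : R :=
  @iota R_CompleteNormedModule (is_euler_rotation_number beta e).

(* Main.v *)
(* After x(theta) |-> y(t) with theta = phi(t), y = x(phi(t)) phi'(t)^(-1/2), a
   Hill equation x'' = -q x becomes y'' = -p y with
   p = q(phi) phi'^2 + (1/2) {phi, t}, and its rotation number does not change
   when phi commutes with translation by 2 pi.  Take for phi the lift of the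
   Moebius map tan(phi/2) = l tan(t/2) with l = exp(a e),
   a = B / (2 B + 3/2), B = 7 beta.  Although 1 + B / (1 + e cos theta) is not
   monotone in e, the transformed potential is: with C = cos(phi), its
   derivative in e is a positive factor times
   a e (B (1 + C^2) + 3 C^2 + (3/2) e C^3), because this choice of a cancels the
   terms which are linear in C.  Sturm comparison of the angles, which solve
   eta' = cos^2 eta + q sin^2 eta, gives the monotonicity.  For e > 0 the
   transformed potential exceeds its constant value 1 + B at e = 0 by a uniform
   amount, and comparison with a constant potential gives the strict
   inequality. *)
Require Import Defs.
From Stdlib Require Import Reals Lra Lia Factorial.
From Coquelicot Require Import Coquelicot.
Open Scope R_scope.

(** * Existence of solutions of the linear equation *)

(** Pointwise comparison of the original coefficients fails already to first order: at e = 0 the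
    derivative of 1 + B / (1 + e cos theta) in e is - B cos theta, which takes both signs. After the
    change of time with l = exp(a e) this derivative becomes ((2 B + 3/2) a - B) cos t, so the value
    of a is forced. Moebius maps suit the purpose because their Schwarzian is explicit, {phi, t} =
    (1 - phi'^2) / 2, and because they form a one-parameter group: with s = a e, 1 / phi' = cosh s -
    cos t sinh s and cos(phi) / phi' = cos t cosh s - sinh s, and d/ds exchanges these two functions
    up to sign. The rotation number survives since phi fixes every 2 pi k and the factor phi'^(-1/2)
    is positive, so that zeros and signs of a solution are kept; an argument therefore only has to
    be known up to a bounded error. The number under study is a definite description, so existence
    of the fundamental solution, existence of the limit, and its independence of the vector and of
    the argument all have to be established. *)

Lemma nonneg_derive_le (f df : R -> R) (a b : R) :
  a <= b ->
  (forall x, a <= x <= b -> is_derive f x (df x)) ->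
  (forall x, a <= x <= b -> 0 <= df x) ->
  f a <= f b.
Proof.
  intros Hab Hf Hdf.
  destruct (MVT_gen f a b df) as [c [Hc E]].
  - intros x Hx. rewrite Rmin_left, Rmax_right in Hx by lra. apply Hf; lra.
  - intros x Hx. rewrite Rmin_left, Rmax_right in Hx by lra.
    apply continuity_pt_filterlim, (ex_derive_continuous f).
    exists (df x); apply Hf; lra.
  - rewrite Rmin_left, Rmax_right in Hc by lra.
    specialize (Hdf c Hc). nra.
Qed.

Lemma zero_derive_const (f : R -> R) :
  (forall x, is_derive f x 0) -> forall x, f x = f 0.
Proof.
  intros Hf x.
  destruct (MVT_gen f 0 x (fun _ => 0)) as [c [_ E]].
  - intros; apply Hf.
  - intros y _. apply continuity_pt_filterlim, (ex_derive_continuous f).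
    exists 0; apply Hf.
  - lra.
Qed.

(** Both functions K s^(n+1) / (n+1) + f(s) and K s^(n+1) / (n+1) - f(s) vanish at 0 and are
    non-decreasing for s >= 0. *)
Lemma derive_pow_bound_pos (f g : R -> R) (K : R) (n : nat) :
  f 0 = 0 -> (forall t, is_derive f t (g t)) ->
  (forall t, Rabs (g t) <= K * Rabs t ^ n) ->
  forall t, 0 <= t -> Rabs (f t) <= K * Rabs t ^ S n / INR (S n).
Proof.
  intros f0 Hf Hg t Ht.
  assert (Hn : 0 < INR (S n)) by (apply lt_0_INR; lia).
  assert (Hd : forall c x, is_derive
      (fun s => K * s ^ S n / INR (S n) + c * f s) x (K * x ^ n + c * g x)).
  { intros c x. auto_derive.
    - exists (g x); apply Hf.
    - replace (Derive (fun x0 => f x0) x) with (g x)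
        by (symmetry; apply is_derive_unique, Hf).
      change (match n with O => 1 | S _ => INR n + 1 end) with (INR (S n)).
      simpl pred. field. lra. }
  assert (Hc : forall c, c = 1 \/ c = -1 ->
      0 <= K * t ^ S n / INR (S n) + c * f t).
  { intros c Hcc.
    replace 0 with (K * 0 ^ S n / INR (S n) + c * f 0)
      by (rewrite f0; simpl; field; apply Rgt_not_eq, Hn).
    apply (nonneg_derive_le (fun s => K * s ^ S n / INR (S n) + c * f s)
             (fun x => K * x ^ n + c * g x)); [lra | intros; apply Hd |].
    intros x Hx. specialize (Hg x). rewrite (Rabs_pos_eq x) in Hg by lra.
    apply Rabs_le_between in Hg. destruct Hcc; subst c; lra. }
  rewrite (Rabs_pos_eq t) by lra.
  apply Rabs_le_between. split.
  - pose proof (Hc 1 (or_introl eq_refl)). lra.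
  - pose proof (Hc (-1) (or_intror eq_refl)). lra.
Qed.

Lemma derive_pow_bound (f g : R -> R) (K : R) (n : nat) :
  f 0 = 0 -> (forall t, is_derive f t (g t)) ->
  (forall t, Rabs (g t) <= K * Rabs t ^ n) ->
  forall t, Rabs (f t) <= K * Rabs t ^ S n / INR (S n).
Proof.
  intros f0 Hf Hg t.
  destruct (Rle_lt_dec 0 t) as [Ht | Ht].
  - now apply derive_pow_bound_pos with g.
  - rewrite <- (Ropp_involutive t), (Rabs_Ropp (- t)).
    apply (derive_pow_bound_pos (fun s => f (- s)) (fun s => - g (- s))).
    + now rewrite Ropp_0.
    + intro s. auto_derive.
      * exists (g (- s)); apply Hf.
      * replace (Derive (fun x0 => f x0) (- s)) with (g (- s))
          by (symmetry; apply is_derive_unique, Hf). ring.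
    + intro s. rewrite Rabs_Ropp, <- (Rabs_Ropp s). apply Hg.
    + lra.
Qed.

(** The majorants make the derivatives converge normally on the ball of radius |x| + 1, which allows
    differentiation term by term near x. *)
Lemma is_derive_Series (f f' : nat -> R -> R) :
  (forall n x, is_derive (f n) x (f' n x)) ->
  (forall x, ex_series (fun n => f n x)) ->
  (forall r, 0 < r -> exists A : nat -> R, ex_series A /\
     forall n y, Rabs y <= r -> Rabs (f' n y) <= A n) ->
  forall x, is_derive (fun y => Series (fun n => f n y)) x
                      (Series (fun n => f' n x)).
Proof.
  intros Hf Hs HA x. apply is_derive_Reals.
  assert (Hr : 0 < Rabs x + 1) by (pose proof (Rabs_pos x); lra).
  set (r := mkposreal _ Hr).
  destruct (HA r Hr) as [A [sA bA]].
  destruct (CVN_CVU_r f' r) with (x := x) as [e He].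
  - exists A, (Series A). split.
    + assert (sA' : is_series (fun k => Rabs (A k)) (Series A)).
      { apply is_series_ext with A; [| now apply Series_correct].
        intro n. symmetry; apply Rabs_pos_eq.
        apply Rle_trans with (Rabs (f' n 0)); [apply Rabs_pos |].
        apply bA. rewrite Rabs_R0. apply Rlt_le, Hr. }
      apply is_series_Reals in sA'. exact sA'.
    + intros n y Hy. apply bA. unfold Boule in Hy. rewrite Rminus_0_r in Hy.
      apply Rlt_le, Hy.
  - simpl; lra.
  - apply (CVU_derivable (fun n => SP f n) (fun n => SP f' n)
             (fun y => Series (fun n => f n y))
             (fun y => Series (fun n => f' n y)) x e He).
    + intros y _. pose proof (Series_correct _ (Hs y)) as H.
      apply is_series_Reals in H. exact H.
    + intros n y _. apply is_derive_Reals. unfold SP.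
      induction n as [| n IH]; simpl; [apply Hf |].
      apply @is_derive_plus; [apply IH | apply Hf].
    + unfold Boule. replace (x - x) with 0 by ring.
      rewrite Rabs_R0. apply cond_pos.
Qed.

(** These are the increments of the Picard iteration started at the constant (a, b), not the
    iterates; the solution is their sum over n. *)
Fixpoint picard (q : R -> R) (a b : R) (n : nat) : (R -> R) * (R -> R) :=
  match n with
  | O => (fun _ => a, fun _ => b)
  | S n => (fun t => RInt (snd (picard q a b n)) 0 t,
            fun t => RInt (fun s => - q s * fst (picard q a b n) s) 0 t)
  end.

Lemma is_derive_RInt_continuous (f : R -> R) :
  (forall t, continuous f t) -> forall t, is_derive (fun x => RInt f 0 x) t (f t).
Proof.
  intros Hf t. apply is_derive_RInt with 0; [| apply Hf].
  apply filter_forall. intro y. apply @RInt_correct.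
  apply @ex_RInt_continuous. intros; apply Hf.
Qed.

Section LinearEquation.

Variables (q : R -> R) (M : R).
Hypothesis q_cont : forall t, continuous q t.
Hypothesis q_bound : forall t, Rabs (q t) <= M.

Lemma picard_continuous (a b : R) (n : nat) (t : R) :
  continuous (fst (picard q a b n)) t /\ continuous (snd (picard q a b n)) t.
Proof.
  revert t; induction n as [| n IH]; intro t.
  - split; apply continuous_const.
  - split; simpl.
    + apply (ex_derive_continuous (fun t => RInt (snd (picard q a b n)) 0 t)).
      eexists. apply is_derive_RInt_continuous. intro; apply IH.
    + apply (ex_derive_continuous
               (fun t => RInt (fun s => - q s * fst (picard q a b n) s) 0 t)).
      eexists. apply is_derive_RInt_continuous. intro s.
      apply @continuous_mult; [apply @continuous_opp, q_cont | apply IH].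
Qed.

Lemma picard_derive (a b : R) (n : nat) (t : R) :
  is_derive (fst (picard q a b (S n))) t (snd (picard q a b n) t) /\
  is_derive (snd (picard q a b (S n))) t (- q t * fst (picard q a b n) t).
Proof.
  split; simpl.
  - apply is_derive_RInt_continuous. intro; apply picard_continuous.
  - apply (is_derive_RInt_continuous (fun s => - q s * fst (picard q a b n) s)).
    intro s. apply @continuous_mult;
      [apply @continuous_opp, q_cont | apply picard_continuous].
Qed.

(** Each integration of |t|^n contributes a factor 1 / (n+1), whence the factorial. The constant M +
    1 serves both components: it dominates the coefficient 1 of the first and the coefficient M of
    the second. *)
Lemma picard_bound (a b : R) (n : nat) (t : R) :
  let C := Rabs a + Rabs b in
  Rabs (fst (picard q a b n) t) <= C * (M + 1) ^ n / INR (fact n) * Rabs t ^ n /\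
  Rabs (snd (picard q a b n) t) <= C * (M + 1) ^ n / INR (fact n) * Rabs t ^ n.
Proof.
  intro C.
  assert (M0 : 0 <= M) by (eapply Rle_trans; [apply Rabs_pos | apply (q_bound 0)]).
  assert (C0 : 0 <= C)
    by (unfold C; pose proof (Rabs_pos a); pose proof (Rabs_pos b); lra).
  revert t; induction n as [| n IH]; intro t.
  - simpl. pose proof (Rabs_pos a); pose proof (Rabs_pos b). unfold C. lra.
  - set (K := C * (M + 1) ^ n / INR (fact n)) in *.
    assert (K0 : 0 <= K).
    { unfold K. apply Rdiv_le_0_compat; [| apply INR_fact_lt_0].
      apply Rmult_le_pos; [exact C0 | apply pow_le; lra]. }
    replace (C * (M + 1) ^ S n / INR (fact (S n)) * Rabs t ^ S n)
      with ((K * (M + 1)) * Rabs t ^ S n / INR (S n)).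
    2:{ unfold K. rewrite fact_simpl, mult_INR. simpl pow. field.
        split; [apply INR_fact_neq_0 | apply not_0_INR; lia]. }
    split.
    + apply (derive_pow_bound _ (snd (picard q a b n))).
      * apply (RInt_point (V := R_CompleteNormedModule)).
      * intro s; exact (proj1 (picard_derive a b n s)).
      * intro s. destruct (IH s) as [_ H].
        assert (0 <= K * Rabs s ^ n) by (apply Rmult_le_pos;
          [exact K0 | apply pow_le, Rabs_pos]). nra.
    + apply (derive_pow_bound _ (fun s => - q s * fst (picard q a b n) s)).
      * apply (RInt_point (V := R_CompleteNormedModule)).
      * intro s; exact (proj2 (picard_derive a b n s)).
      * intro s. destruct (IH s) as [H _]. rewrite Rabs_mult, Rabs_Ropp.
        replace (K * (M + 1) * Rabs s ^ n) with ((M + 1) * (K * Rabs s ^ n)) by ring.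
        apply Rmult_le_compat; try apply Rabs_pos; [pose proof (q_bound s); lra | exact H].
Qed.

End LinearEquation.

Lemma ex_series_exp_terms (C M x : R) :
  ex_series (fun n => C * M ^ n / INR (fact n) * x ^ n).
Proof.
  exists (C * exp (M * x)).
  apply is_series_ext with (fun n => scal C (scal (pow_n (M * x) n) (/ INR (fact n)))).
  - intro n. rewrite pow_n_pow, Rpow_mult_distr.
    unfold scal; simpl; unfold mult; simpl. field. apply INR_fact_neq_0.
  - apply @is_series_scal_l, is_exp_Reals.
Qed.

Lemma linear_solution_exists (q : R -> R) (M : R) :
  (forall t, continuous q t) -> (forall t, Rabs (q t) <= M) ->
  forall a b : R, exists u v : R -> R,
    u 0 = a /\ v 0 = b /\
    (forall t, is_derive u t (v t)) /\ (forall t, is_derive v t (- q t * u t)).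
Proof.
  intros qc qb a b.
  assert (M0 : 0 <= M) by (eapply Rle_trans; [apply Rabs_pos | apply (qb 0)]).
  set (un := fun n => fst (picard q a b n)).
  set (vn := fun n => snd (picard q a b n)).
  set (A := fun r n => (Rabs a + Rabs b) * (M + 1) ^ n / INR (fact n) * r ^ n).
  assert (sA : forall r, ex_series (A r)) by (intro; apply ex_series_exp_terms).
  assert (A0 : forall r n, 0 <= r -> 0 <= A r n).
  { intros r n Hr. unfold A. apply Rmult_le_pos; [| now apply pow_le].
    apply Rdiv_le_0_compat; [| apply INR_fact_lt_0].
    apply Rmult_le_pos; [| apply pow_le; lra].
    pose proof (Rabs_pos a); pose proof (Rabs_pos b); lra. }
  assert (bA : forall r n t, Rabs t <= r -> Rabs (un n t) <= A r n /\ Rabs (vn n t) <= A r n).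
  { intros r n t Ht.
    assert (H : A (Rabs t) n <= A r n).
    { unfold A. apply Rmult_le_compat_l.
      - apply Rdiv_le_0_compat; [| apply INR_fact_lt_0].
        apply Rmult_le_pos; [| apply pow_le; lra].
        pose proof (Rabs_pos a); pose proof (Rabs_pos b); lra.
      - apply pow_incr. split; [apply Rabs_pos | exact Ht]. }
    destruct (picard_bound q M qc qb a b n t) as [H1 H2].
    split; eapply Rle_trans; eassumption. }
  assert (su : forall t, ex_series (fun n => un n t)).
  { intro t. apply @ex_series_le with (A (Rabs t)); [| apply sA].
    intro n. apply bA. lra. }
  assert (sv : forall t, ex_series (fun n => vn n t)).
  { intro t. apply @ex_series_le with (A (Rabs t)); [| apply sA].
    intro n. apply bA. lra. }
  exists (fun t => Series (fun n => un n t)), (fun t => Series (fun n => vn n t)).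
  (* At time 0 every increment after the initial one is an integral over a point, so the initial
     values are those of the constant term. *)
  assert (at0 : forall w : nat -> R, (forall n, w (S n) = 0) -> Series w = w 0%nat).
  { intros w Hw. rewrite Series_incr_1.
    - rewrite (Series_ext _ (fun k => 0 * w k)) by (intro; rewrite Hw; ring).
      rewrite Series_scal_l. ring.
    - apply ex_series_incr_1. apply ex_series_ext with (fun k => 0 * 0 ^ k).
      + intro n; rewrite Hw; apply Rmult_0_l.
      + apply @ex_series_scal, ex_series_geom. rewrite Rabs_R0; lra. }
  (* Differentiation kills the constant term and lowers the index of the others by one, so the
     derived series is a shifted copy of the series of the other component. *)
  assert (sumD : forall f g : nat -> R -> R,
      (forall x, is_derive (f O) x 0) ->
      (forall n x, is_derive (f (S n)) x (g n x)) ->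
      (forall x, ex_series (fun n => f n x)) ->
      (forall r, 0 < r -> exists B : nat -> R, ex_series B /\
         forall n y, Rabs y <= r -> Rabs (g n y) <= B n) ->
      forall x, is_derive (fun y => Series (fun n => f n y)) x
                          (Series (fun n => g n x))).
  { intros f g f0 fS fs gb x.
    set (g' := fun n => match n with O => fun _ => 0 | S m => g m end).
    replace (Series (fun n => g n x)) with (Series (fun n => g' n x))
      by (now rewrite Series_incr_1_aux).
    apply is_derive_Series; [| exact fs |].
    - intros [| n] y; [apply f0 | apply fS].
    - intros r Hr. destruct (gb r Hr) as [B [sB bB]].
      exists (fun n => match n with O => 0 | S m => B m end). split.
      + now apply ex_series_incr_1.
      + intros [| n] y Hy; simpl; [rewrite Rabs_R0; lra | now apply bB]. }
  split; [| split; [| split]].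
  - rewrite at0; [reflexivity |]. intro n.
    apply (RInt_point (V := R_CompleteNormedModule)).
  - rewrite at0; [reflexivity |]. intro n.
    apply (RInt_point (V := R_CompleteNormedModule)).
  - apply (sumD un vn); [| | apply su |].
    + intro x; exact (is_derive_const a x).
    + intros n x; exact (proj1 (picard_derive q qc a b n x)).
    + intros r Hr. exists (A r). split; [apply sA | intros; now apply bA].
  - intro t. rewrite <- Series_scal_l.
    apply (sumD vn (fun n s => - q s * un n s)); [| | apply sv |].
    + intro x; exact (is_derive_const b x).
    + intros n x; exact (proj2 (picard_derive q qc a b n x)).
    + intros r Hr. exists (fun n => M * A r n). split.
      * apply @ex_series_scal, sA.
      * intros n y Hy. rewrite Rabs_mult, Rabs_Ropp.
        apply Rmult_le_compat; try apply Rabs_pos; [apply qb | now apply bA].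
Qed.

(** * The angle of a solution *)

(** Polar angle equation of the phase point (u', u) = r (cos eta, sin eta) of u'' = - q u. The
    velocity is the first coordinate, as in the first-order system for [gamma]. *)
Definition is_angle (q eta : R -> R) : Prop :=
  forall t, is_derive eta t (cos (eta t) ^ 2 + q t * sin (eta t) ^ 2).

Definition is_solution (q u v : R -> R) : Prop :=
  (forall t, is_derive u t (v t)) /\ (forall t, is_derive v t (- q t * u t)).

Lemma sin2_cos2_pow (x : R) : sin x ^ 2 + cos x ^ 2 = 1.
Proof. pose proof (sin2_cos2 x). unfold Rsqr in *. lra. Qed.

Lemma polar_exists (a b : R) : 0 < a ^ 2 + b ^ 2 ->
  exists h, a = sqrt (a ^ 2 + b ^ 2) * cos h /\ b = sqrt (a ^ 2 + b ^ 2) * sin h.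
Proof.
  intro H. set (r := sqrt (a ^ 2 + b ^ 2)).
  assert (Hr : 0 < r) by now apply sqrt_lt_R0.
  assert (Hrr : r * r = a ^ 2 + b ^ 2) by (apply sqrt_sqrt; lra).
  assert (Hc : (a / r) * (a / r) + (b / r) * (b / r) = 1).
  { replace 1 with ((a ^ 2 + b ^ 2) / (r * r)) by (rewrite Hrr; field; lra).
    field. lra. }
  assert (Hb : -1 <= a / r <= 1) by (split; nra).
  assert (Hs : sin (acos (a / r)) = Rabs (b / r)).
  { rewrite sin_acos by exact Hb.
    replace (1 - (a / r)²) with ((b / r)²) by (unfold Rsqr; lra).
    apply sqrt_Rsqr_abs. }
  destruct (Rle_lt_dec 0 (b / r)) as [Hp | Hn].
  - exists (acos (a / r)). rewrite cos_acos, Hs, Rabs_pos_eq by assumption.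
    split; field; lra.
  - exists (- acos (a / r)). rewrite cos_neg, sin_neg, cos_acos, Hs, Rabs_left
      by assumption.
    split; field; lra.
Qed.

(** The squared norm E of (v, u) has E' = 2 u v (1 - q), hence |E'| <= (M + 1) E, and an exponential
    factor turns this into monotonicity. *)
Lemma solution_nonzero (q u v : R -> R) (M : R) :
  (forall t, Rabs (q t) <= M) -> is_solution q u v ->
  0 < v 0 ^ 2 + u 0 ^ 2 -> forall t, 0 < v t ^ 2 + u t ^ 2.
Proof.
  intros qb [Hu Hv] H0 t. set (K := M + 1).
  (* The sign c is 1 for forward and -1 for backward time; in both cases c E(s) exp(c K s) is
     non-decreasing. *)
  assert (HE : forall c s, is_derive (fun s => c * ((v s ^ 2 + u s ^ 2) * exp (c * K * s))) s
    (exp (c * K * s) * (c * 2 * u s * v s * (1 - q s) + c * c * K * (v s ^ 2 + u s ^ 2)))).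
  { intros c s. auto_derive.
    - split; [exists (- q s * u s); apply Hv | split; [exists (v s); apply Hu | easy]].
    - replace (Derive (fun x => u x) s) with (v s)
        by (symmetry; apply is_derive_unique, Hu).
      replace (Derive (fun x => v x) s) with (- q s * u s)
        by (symmetry; apply is_derive_unique, Hv).
      ring. }
  assert (Hpos : forall c s, c = 1 \/ c = -1 -> 0 <= exp (c * K * s) *
      (c * 2 * u s * v s * (1 - q s) + c * c * K * (v s ^ 2 + u s ^ 2))).
  { intros c s Hc. apply Rmult_le_pos; [apply Rlt_le, exp_pos |].
    pose proof (qb s) as Hq. apply Rabs_le_between in Hq.
    assert (- K <= 1 - q s <= K) by (unfold K; lra).
    assert (HP : - (v s ^ 2 + u s ^ 2) <= 2 * u s * v s <= v s ^ 2 + u s ^ 2)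
      by (split; [pose proof (pow2_ge_0 (u s + v s)) | pose proof (pow2_ge_0 (u s - v s))]; lra).
    assert (HPQ : Rabs (2 * u s * v s * (1 - q s)) <= K * (v s ^ 2 + u s ^ 2)).
    { rewrite Rabs_mult, (Rmult_comm K).
      apply Rmult_le_compat; try apply Rabs_pos; now apply Rabs_le_between. }
    apply Rabs_le_between in HPQ. destruct Hc; subst c; lra. }
  destruct (Rle_lt_dec 0 t) as [Ht | Ht].
  - pose proof (nonneg_derive_le _ _ 0 t Ht (fun s _ => HE 1 s)
                  (fun s _ => Hpos 1 s (or_introl eq_refl))) as H.
    simpl in H. rewrite Rmult_0_r, exp_0 in H.
    pose proof (exp_pos (1 * K * t)). simpl in *. nra.
  - pose proof (nonneg_derive_le _ _ t 0 (Rlt_le _ _ Ht) (fun s _ => HE (-1) s)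
                  (fun s _ => Hpos (-1) s (or_intror eq_refl))) as H.
    simpl in H. rewrite Rmult_0_r, exp_0 in H.
    pose proof (exp_pos (-1 * K * t)). simpl in *. nra.
Qed.

(** Instead of lifting the curve (v, u) / r to the line, the angle is obtained by integrating the
    angular velocity [w], which gives its regularity at once. That it really is an argument then
    follows from two conserved quantities, the cosine and the sine of the discrepancy. *)
Lemma angle_of_solution (q u v : R -> R) (M h : R) :
  (forall t, continuous q t) -> (forall t, Rabs (q t) <= M) ->
  is_solution q u v -> 0 < v 0 ^ 2 + u 0 ^ 2 ->
  v 0 = sqrt (v 0 ^ 2 + u 0 ^ 2) * cos h ->
  u 0 = sqrt (v 0 ^ 2 + u 0 ^ 2) * sin h ->
  exists eta, eta 0 = h /\ is_angle q eta /\
    forall t, v t = sqrt (v t ^ 2 + u t ^ 2) * cos (eta t) /\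
              u t = sqrt (v t ^ 2 + u t ^ 2) * sin (eta t).
Proof.
  intros qc qb Hsol H0 Hc Hs.
  pose proof (solution_nonzero q u v M qb Hsol H0) as HE.
  destruct Hsol as [Hu Hv].
  set (r := fun t => sqrt (v t ^ 2 + u t ^ 2)).
  assert (Hr : forall t, 0 < r t) by (intro; apply sqrt_lt_R0, HE).
  assert (Hrr : forall t, r t * r t = v t ^ 2 + u t ^ 2)
    by (intro; apply sqrt_sqrt, Rlt_le, HE).
  set (w := fun t => (v t ^ 2 + q t * u t ^ 2) / (r t * r t)).
  assert (uc : forall t, continuous u t)
    by (intro t; apply (ex_derive_continuous u); eexists; apply Hu).
  assert (vc : forall t, continuous v t)
    by (intro t; apply (ex_derive_continuous v); eexists; apply Hv).
  assert (rr : forall t, v t * v t + u t * u t = r t * r t)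
    by (intro t; rewrite Hrr; ring).
  assert (wc : forall t, continuous w t).
  { intro t. unfold w, Rdiv. apply @continuous_mult.
    - apply @continuous_plus; [| apply @continuous_mult; [apply qc |]];
        (apply @continuous_mult; [| apply @continuous_mult;
           [| apply continuous_const]]); first [apply uc | apply vc].
    - apply (continuous_comp (fun t => r t * r t) Rinv).
      + apply continuous_ext with (fun t => v t * v t + u t * u t).
        * exact rr.
        * apply @continuous_plus; apply @continuous_mult; first [apply uc | apply vc].
      + apply continuity_pt_filterlim, continuity_pt_inv.
        * apply derivable_continuous_pt, derivable_pt_id.
        * specialize (Hr t). nra. }
  set (eta := fun t => h + RInt w 0 t).
  assert (He : forall t, is_derive eta t (w t)).
  { intro t. unfold eta. rewrite <- (Rplus_0_l (w t)).
    apply @is_derive_plus; [apply @is_derive_const |].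
    now apply is_derive_RInt_continuous. }
  assert (e0 : eta 0 = h).
  { unfold eta. rewrite (RInt_point (V := R_CompleteNormedModule)).
    apply Rplus_0_r. }
  assert (ex : forall t, ex_derive u t /\ ex_derive v t /\ ex_derive eta t).
  { intro t. repeat split; eexists; [apply Hu | apply Hv | apply He]. }
  assert (Du : forall t, Derive (fun x => u x) t = v t)
    by (intro; apply is_derive_unique, Hu).
  assert (Dv : forall t, Derive (fun x => v x) t = - q t * u t)
    by (intro; apply is_derive_unique, Hv).
  assert (De : forall t, Derive (fun x => eta x) t = w t)
    by (intro; apply is_derive_unique, He).
  assert (Hrd : forall t, is_derive r t ((1 - q t) * u t * v t / r t)).
  { intro t. unfold r.
    replace ((1 - q t) * u t * v t / sqrt (v t ^ 2 + u t ^ 2))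
      with ((2 * v t * (- q t * u t) + 2 * u t * v t) / (2 * sqrt (v t ^ 2 + u t ^ 2)))
      by (field; apply Rgt_not_eq, (Hr t)).
    apply (is_derive_sqrt (fun t => v t ^ 2 + u t ^ 2)); [| apply HE].
    auto_derive; [split; [apply ex | split; [apply ex | easy]] |].
    rewrite Du, Dv. ring. }
  assert (Dr : forall t, Derive (fun x => r x) t = (1 - q t) * u t * v t / r t)
    by (intro; apply is_derive_unique, Hrd).
  assert (rn : forall t, r t <> 0) by (intro t; specialize (Hr t); lra).
  fold (r 0) in Hc, Hs.
  change (exists eta, eta 0 = h /\ is_angle q eta /\
    forall t, v t = r t * cos (eta t) /\ u t = r t * sin (eta t)).
  clearbody r eta.
  assert (exr : forall t, ex_derive r t) by (intro; eexists; apply Hrd).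
  (* The unit vector (v, u) / r and (cos eta, sin eta) rotate with the same
     angular velocity. *)
  assert (A : forall t, (v t * cos (eta t) + u t * sin (eta t)) / r t = 1).
  { intro t. rewrite (zero_derive_const
      (fun t => (v t * cos (eta t) + u t * sin (eta t)) / r t)).
    - rewrite e0.
      replace (v 0 * cos h + u 0 * sin h) with (r 0 * (sin h ^ 2 + cos h ^ 2))
        by (rewrite Hc, Hs; ring).
      rewrite sin2_cos2_pow. field. apply rn.
    - clear t. intro t. destruct (ex t) as [e1 [e2 e3]].
      auto_derive; [repeat split; auto |].
      rewrite Du, Dv, De, Dr. unfold w.
      set (N := (- q t * u t * cos (eta t) + v t * sin (eta t)) * (r t * r t)
           + (v t ^ 2 + q t * u t ^ 2) * (u t * cos (eta t) - v t * sin (eta t))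
           - (v t * cos (eta t) + u t * sin (eta t)) * ((1 - q t) * u t * v t)).
      replace 0 with (N / (r t * r t * r t))
        by (unfold N; rewrite Hrr; field; split; [apply rn | apply Rgt_not_eq, HE]).
      unfold N. field. apply rn. }
  assert (B : forall t, (u t * cos (eta t) - v t * sin (eta t)) / r t = 0).
  { intro t. rewrite (zero_derive_const
      (fun t => (u t * cos (eta t) - v t * sin (eta t)) / r t)).
    - rewrite e0.
      replace (u 0 * cos h - v 0 * sin h) with 0
        by (rewrite Hc, Hs; ring).
      field. apply rn.
    - clear t. intro t. destruct (ex t) as [e1 [e2 e3]].
      auto_derive; [repeat split; auto |].
      rewrite Du, Dv, De, Dr. unfold w.
      set (N := (v t * cos (eta t) + q t * u t * sin (eta t)) * (r t * r t)
           - (v t ^ 2 + q t * u t ^ 2) * (v t * cos (eta t) + u t * sin (eta t))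
           - (u t * cos (eta t) - v t * sin (eta t)) * ((1 - q t) * u t * v t)).
      replace 0 with (N / (r t * r t * r t))
        by (unfold N; rewrite Hrr; field; split; [apply rn | apply Rgt_not_eq, HE]).
      unfold N. field. apply rn. }
  assert (F : forall t, v t = r t * cos (eta t) /\ u t = r t * sin (eta t)).
  { intro t. specialize (A t). specialize (B t). specialize (rn t).
    assert (A' : v t * cos (eta t) + u t * sin (eta t) = r t)
      by (apply (Rmult_eq_reg_r (/ r t)); [| now apply Rinv_neq_0_compat];
          rewrite Rinv_r by exact rn; exact A).
    assert (B' : u t * cos (eta t) - v t * sin (eta t) = 0)
      by (apply (Rmult_eq_reg_r (/ r t)); [| now apply Rinv_neq_0_compat];
          rewrite Rmult_0_l; exact B).
    pose proof (sin2_cos2_pow (eta t)) as T. rewrite <- A'. split.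
    - replace ((v t * cos (eta t) + u t * sin (eta t)) * cos (eta t))
        with (v t * (sin (eta t) ^ 2 + cos (eta t) ^ 2)
              + sin (eta t) * (u t * cos (eta t) - v t * sin (eta t))) by ring.
      rewrite T, B'. ring.
    - replace ((v t * cos (eta t) + u t * sin (eta t)) * sin (eta t))
        with (u t * (sin (eta t) ^ 2 + cos (eta t) ^ 2)
              - cos (eta t) * (u t * cos (eta t) - v t * sin (eta t))) by ring.
      rewrite T, B'. ring. }
  exists eta. split; [exact e0 | split; [| exact F]].
  intro t. replace (cos (eta t) ^ 2 + q t * sin (eta t) ^ 2) with (w t);
    [apply He |].
  unfold w. destruct (F t) as [F1 F2]. specialize (rn t).
  rewrite F1, F2. field. exact rn.
Qed.

(** * Comparison of angles and rotation numbers *)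

(** The function y |y| is differentiable at 0 as well. This makes D^2 - D |D|, which is 2 min(D,
    0)^2, a differentiable measure of the negative part of D. *)
Lemma is_derive_mult_Rabs (x : R) : is_derive (fun y => y * Rabs y) x (2 * Rabs x).
Proof.
  destruct (Req_dec x 0) as [-> | Hx].
  - apply is_derive_Reals. intros eps Heps. exists (mkposreal eps Heps).
    intros h Hh Hlt. simpl in Hlt. rewrite Rplus_0_l, Rabs_R0.
    replace ((h * Rabs h - 0 * 0) / h - 2 * 0) with (Rabs h) by (field; exact Hh).
    now rewrite Rabs_Rabsolu.
  - auto_derive; [exact Hx |].
    destruct (Rle_lt_dec 0 x) as [Hp | Hn].
    + rewrite sign_eq_1, Rabs_pos_eq by lra. ring.
    + rewrite sign_eq_m1, Rabs_left by lra. ring.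
Qed.

(** The difference equals sin(x + y) sin(x - y). It provides the Lipschitz constant of the angle
    equation. *)
Lemma sin_sqr_sub (x y : R) : Rabs (sin x ^ 2 - sin y ^ 2) <= Rabs (x - y).
Proof.
  replace (sin x ^ 2 - sin y ^ 2) with (sin (x + y) * sin (x - y)).
  2:{ rewrite sin_plus, sin_minus. pose proof (sin2_cos2_pow x).
      pose proof (sin2_cos2_pow y).
      replace ((sin x * cos y + cos x * sin y) * (sin x * cos y - cos x * sin y))
        with (sin x ^ 2 * cos y ^ 2 - cos x ^ 2 * sin y ^ 2) by ring.
      replace (cos x ^ 2) with (1 - sin x ^ 2) by lra.
      replace (cos y ^ 2) with (1 - sin y ^ 2) by lra. ring. }
  rewrite Rabs_mult.
  assert (H1 : Rabs (sin (x + y)) <= 1) by (apply Rabs_le, SIN_bound).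
  assert (H2 : Rabs (sin (x - y)) <= Rabs (x - y)).
  { destruct (MVT_gen sin 0 (x - y) cos) as [c [_ E]].
    - intros; auto_derive; auto; ring.
    - intros z _. apply continuity_sin.
    - rewrite sin_0, !Rminus_0_r in E. rewrite E, Rabs_mult.
      assert (Rabs (cos c) <= 1) by (apply Rabs_le, COS_bound).
      pose proof (Rabs_pos (x - y)). nra. }
  pose proof (Rabs_pos (sin (x - y))). nra.
Qed.

(* With [D := zeta - eta] one has [D' >= - (M + 1) |D|], so that
   [min(D, 0)^2] satisfies a Gronwall inequality. *)
Lemma angle_le (q p eta zeta : R -> R) (M : R) :
  (forall t, Rabs (q t) <= M) -> (forall t, q t <= p t) ->
  is_angle q eta -> is_angle p zeta -> eta 0 <= zeta 0 ->
  forall t, 0 <= t -> eta t <= zeta t.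
Proof.
  intros qb qp He Hz H0 t Ht.
  set (D := fun t => zeta t - eta t).
  set (D' := fun t => (cos (zeta t) ^ 2 + p t * sin (zeta t) ^ 2)
                      - (cos (eta t) ^ 2 + q t * sin (eta t) ^ 2)).
  assert (HD : forall t, is_derive D t (D' t))
    by (intro s; apply @is_derive_minus; [apply Hz | apply He]).
  assert (HDn : forall s, - (M + 1) * Rabs (D s) <= D' s).
  { intro s. unfold D'.
    pose proof (sin2_cos2_pow (eta s)); pose proof (sin2_cos2_pow (zeta s)).
    replace (cos (eta s) ^ 2) with (1 - sin (eta s) ^ 2) by lra.
    replace (cos (zeta s) ^ 2) with (1 - sin (zeta s) ^ 2) by lra.
    (* With cos^2 = 1 - sin^2 one has D' = (p - q) sin^2 zeta + (q - 1)(sin^2 zeta - sin^2 eta): the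
       first summand has a sign, the second is at most (M + 1) |D| in modulus. *)
    assert (P : 0 <= (p s - q s) * sin (zeta s) ^ 2)
      by (apply Rmult_le_pos; [specialize (qp s); lra | apply pow2_ge_0]).
    assert (Q : Rabs ((q s - 1) * (sin (zeta s) ^ 2 - sin (eta s) ^ 2))
                <= (M + 1) * Rabs (D s)).
    { rewrite Rabs_mult. apply Rmult_le_compat; try apply Rabs_pos.
      - eapply Rle_trans; [apply Rabs_triang |].
        rewrite Rabs_Ropp, Rabs_R1. specialize (qb s). lra.
      - apply sin_sqr_sub. }
    apply Rabs_le_between in Q. lra. }
  set (m := fun s => D s * D s - D s * Rabs (D s)).
  assert (Hm : forall s, is_derive m s ((2 * D s - 2 * Rabs (D s)) * D' s)).
  { intro s. rewrite (Rmult_comm _ (D' s)).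
    apply (is_derive_comp (fun x => x * x - x * Rabs x) D s (2 * D s - 2 * Rabs (D s))); [| apply HD].
    assert (Hx : is_derive (fun x => x * x) (D s) (2 * D s))
      by (auto_derive; [easy | ring]).
    exact (is_derive_minus _ _ _ _ _ Hx (is_derive_mult_Rabs (D s))). }
  assert (HG : - (m 0 * exp (- 2 * (M + 1) * 0)) <= - (m t * exp (- 2 * (M + 1) * t))).
  { apply (nonneg_derive_le (fun s => - (m s * exp (- 2 * (M + 1) * s)))
      (fun s => exp (- 2 * (M + 1) * s)
         * (2 * (M + 1) * m s - (2 * D s - 2 * Rabs (D s)) * D' s)));
      [exact Ht | |].
    - intros s _. auto_derive.
      + eexists; apply Hm.
      + replace (Derive (fun x => m x) s) with ((2 * D s - 2 * Rabs (D s)) * D' s)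
          by (symmetry; apply is_derive_unique, Hm). ring.
    - intros s _. apply Rmult_le_pos; [apply Rlt_le, exp_pos |].
      specialize (HDn s). unfold m.
      destruct (Rle_lt_dec 0 (D s)) as [Hp | Hn].
      + rewrite Rabs_pos_eq by exact Hp. lra.
      + rewrite Rabs_left in * by exact Hn. nra. }
  rewrite Rmult_0_r, exp_0 in HG.
  assert (m0 : m 0 = 0) by (unfold m; rewrite Rabs_pos_eq by (unfold D; lra); ring).
  rewrite m0 in HG.
  pose proof (exp_pos (- 2 * (M + 1) * t)) as Hexp.
  assert (Hmt : m t <= 0) by nra.
  unfold m in Hmt. cut (0 <= D t); [unfold D; lra |].
  destruct (Rle_lt_dec 0 (D t)) as [Hp | Hn]; [exact Hp |].
  rewrite Rabs_left in Hmt by exact Hn. nra.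
Qed.

Lemma trig_sqr_shift (x : R) (j : Z) :
  cos (x + IZR j * PI) ^ 2 = cos x ^ 2 /\ sin (x + IZR j * PI) ^ 2 = sin x ^ 2.
Proof.
  assert (S0 : sin (IZR j * PI) = 0) by (apply sin_eq_0_1; now exists j).
  pose proof (sin2_cos2_pow (IZR j * PI)) as E. rewrite S0 in E.
  assert (C1 : cos (IZR j * PI) ^ 2 = 1) by lra.
  rewrite cos_plus, sin_plus, S0. split.
  - replace ((cos x * cos (IZR j * PI) - sin x * 0) ^ 2)
      with (cos x ^ 2 * cos (IZR j * PI) ^ 2) by ring.
    rewrite C1; ring.
  - replace ((sin x * cos (IZR j * PI) + cos x * 0) ^ 2)
      with (sin x ^ 2 * cos (IZR j * PI) ^ 2) by ring.
    rewrite C1; ring.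
Qed.

(** Only squares of cos eta and sin eta enter the angle equation, so it is invariant under eta ->
    eta + j pi, and under time shifts by a period of q. With T = 0 it gives the bare translates by
    multiples of pi. *)
Lemma is_angle_shift (q eta : R -> R) (T : R) (j : Z) :
  (forall t, q (t + T) = q t) -> is_angle q eta ->
  is_angle q (fun t => eta (t + T) + IZR j * PI).
Proof.
  intros qp He t. destruct (trig_sqr_shift (eta (t + T)) j) as [-> ->].
  rewrite <- (qp t).
  replace (cos (eta (t + T)) ^ 2 + q (t + T) * sin (eta (t + T)) ^ 2)
    with (1 * (cos (eta (t + T)) ^ 2 + q (t + T) * sin (eta (t + T)) ^ 2) + 0) by ring.
  apply @is_derive_plus; [| apply @is_derive_const].
  apply (is_derive_comp eta (fun t => t + T)); [apply He |].
  auto_derive; [easy | ring].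
Qed.

(** * Existence of the rotation number for periodic coefficients *)

Lemma exists_floor_PI (x : R) : exists j : Z, IZR j * PI <= x <= IZR j * PI + PI.
Proof.
  exists (Int_part (x / PI)). destruct (base_Int_part (x / PI)) as [H1 H2].
  pose proof PI_RGT_0 as P.
  assert (E : x = x / PI * PI) by (field; lra). rewrite E at 2 3.
  split; nra.
Qed.

(** Iterating the hypothesis compares a(m n) with m a(n) and, by symmetry, with n a(m). Hence a(n)/n
    and a(m)/m lie within 2K/n and 2K/m of the common value a(m n)/(m n), which makes the quotients
    a Cauchy sequence. *)
Lemma quasi_additive_lim (a : nat -> R) (K : R) :
  (forall m n, Rabs (a (m + n)%nat - a m - a n) <= K) ->
  exists l : R, is_lim_seq (fun n => a n / INR n) l.
Proof.
  intro Ha.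
  assert (K0 : 0 <= K) by (eapply Rle_trans; [apply Rabs_pos | apply (Ha O O)]).
  assert (Hmul : forall m n, Rabs (a (m * S n)%nat - INR m * a (S n)) <= (INR m + 1) * K).
  { intros m n. induction m as [| m IH].
    (* The extra 1 in (m + 1) K pays for a(0), which need not vanish but satisfies |a(0)| <= K by
       the hypothesis at (0, 0). *)
    - specialize (Ha O O). simpl in *.
      replace (a O - 0 * a (S n)) with (- (a O - a O - a O)) by ring.
      rewrite Rabs_Ropp. lra.
    - rewrite S_INR. replace (S m * S n)%nat with (m * S n + S n)%nat by lia.
      specialize (Ha (m * S n)%nat (S n)).
      replace (a (m * S n + S n)%nat - (INR m + 1) * a (S n))
        with ((a (m * S n + S n)%nat - a (m * S n)%nat - a (S n))
              + (a (m * S n)%nat - INR m * a (S n))) by ring.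
      eapply Rle_trans; [apply Rabs_triang |]. lra. }
  assert (Hd : forall m n, Rabs (a (S m * S n)%nat / (INR (S m) * INR (S n)) - a (S n) / INR (S n))
                           <= 2 * K / INR (S n)).
  { intros m n. specialize (Hmul (S m) n).
    assert (Pm : 1 <= INR (S m)) by (rewrite S_INR; pose proof (pos_INR m); lra).
    assert (Pn : 1 <= INR (S n)) by (rewrite S_INR; pose proof (pos_INR n); lra).
    replace (a (S m * S n)%nat / (INR (S m) * INR (S n)) - a (S n) / INR (S n))
      with ((a (S m * S n)%nat - INR (S m) * a (S n)) / (INR (S m) * INR (S n)))
      by (field; lra).
    rewrite Rabs_div by nra. rewrite (Rabs_pos_eq (INR (S m) * INR (S n))) by nra.
    apply Rle_trans with ((2 * INR (S m)) * K / (INR (S m) * INR (S n))).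
    - apply Rmult_le_compat_r; [apply Rlt_le, Rinv_0_lt_compat; nra |]. nra.
    - right. field. lra. }
  assert (Hc : ex_lim_seq_cauchy (fun n => a n / INR n)).
  { intro eps.
    (* The two errors 2K/n and 2K/m add up to at most 4K/N; the summand 1 keeps the denominator
       positive when K = 0. *)
    destruct (archimed_cor1 (eps / (4 * K + 1))) as [N [HN1 HN2]].
    { apply Rdiv_lt_0_compat; [apply eps | lra]. }
    assert (PN : 0 < INR N) by (apply lt_0_INR; lia).
    assert (Hsm : 4 * K / INR N < eps).
    { apply Rle_lt_trans with ((4 * K + 1) * / INR N).
      - apply Rmult_le_compat_r; [apply Rlt_le, Rinv_0_lt_compat, PN | lra].
      - apply Rlt_le_trans with ((4 * K + 1) * (eps / (4 * K + 1))).
        + apply Rmult_lt_compat_l; [lra | exact HN1].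
        + right. field. lra. }
    exists N. intros n m Hn Hm.
    destruct n as [| n]; [lia |]. destruct m as [| m]; [lia |].
    pose proof (Hd m n) as H1. pose proof (Hd n m) as H2.
    replace (S n * S m)%nat with (S m * S n)%nat in H2 by lia.
    rewrite (Rmult_comm (INR (S n))) in H2.
    assert (B : forall k, (N <= k)%nat -> 2 * K / INR k <= 2 * K / INR N).
    { intros k Hk. apply Rmult_le_compat_l; [lra |].
      apply Rinv_le_contravar; [exact PN | now apply le_INR]. }
    pose proof (B _ Hn). pose proof (B _ Hm).
    apply Rabs_le_between in H1. apply Rabs_le_between in H2.
    apply Rabs_lt_between. unfold Rdiv in *. lra. }
  apply ex_lim_seq_cauchy_corr in Hc. exact Hc.
Qed.

(** Quantifying over all angle functions makes the independence of the initial angle part of the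
    notion; [angle_exists] shows that it is not vacuous for bounded continuous coefficients. *)
Definition is_rotation (q : R -> R) (rho : R) : Prop :=
  forall eta, is_angle q eta ->
    is_lim_seq (fun k => eta (2 * PI * INR k) / (2 * PI * INR k)) rho.

Lemma lim_bounded_diff (f g : nat -> R) (K rho : R) :
  (forall k, Rabs (f k - g k) <= K) ->
  is_lim_seq (fun k => g k / (2 * PI * INR k)) rho ->
  is_lim_seq (fun k => f k / (2 * PI * INR k)) rho.
Proof.
  intros Hfg Hg.
  assert (Hz : is_lim_seq (fun k => (f k - g k) / (2 * PI * INR k)) 0).
  { assert (HK : forall c, is_lim_seq (fun k => c / (2 * PI) * / INR k) 0).
    { intro c. replace (Finite 0) with (Rbar_mult (c / (2 * PI)) 0)
        by (simpl; f_equal; ring).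
      apply is_lim_seq_scal_l.
      apply (is_lim_seq_inv _ _ is_lim_seq_INR). discriminate. }
    apply is_lim_seq_le_le_loc with
      (fun k => (- K) / (2 * PI) * / INR k) (fun k => K / (2 * PI) * / INR k);
      [| apply HK | apply HK].
    exists 1%nat. intros k Hk. specialize (Hfg k).
    assert (0 < INR k) by (apply lt_0_INR; lia). pose proof PI_RGT_0.
    apply Rabs_le_between in Hfg.
    assert (E : forall c, c / (2 * PI) * / INR k = c / (2 * PI * INR k))
      by (intro; field; lra).
    rewrite !E. split; (apply Rmult_le_compat_r;
      [apply Rlt_le, Rinv_0_lt_compat; nra | lra]). }
  apply is_lim_seq_ext with
    (fun k => g k / (2 * PI * INR k) + (f k - g k) / (2 * PI * INR k)).
  - intro k. unfold Rdiv. ring.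
  - replace (Finite rho) with (Finite (rho + 0)) by (f_equal; ring).
    now apply is_lim_seq_plus'.
Qed.

Lemma angle_exists (q : R -> R) (M : R) :
  (forall t, continuous q t) -> (forall t, Rabs (q t) <= M) ->
  exists eta, eta 0 = 0 /\ is_angle q eta.
Proof.
  intros qc qb.
  destruct (linear_solution_exists q M qc qb 0 1) as [u [v [u0 [v0 [Hu Hv]]]]].
  assert (E : sqrt (v 0 ^ 2 + u 0 ^ 2) = 1).
  { rewrite u0, v0. replace (1 ^ 2 + 0 ^ 2) with 1 by ring. apply sqrt_1. }
  destruct (angle_of_solution q u v M 0 qc qb (conj Hu Hv)) as [eta [e0 [He _]]].
  - rewrite u0, v0. lra.
  - rewrite E, cos_0. lra.
  - rewrite E, sin_0. lra.
  - now exists eta.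
Qed.

(** Translates of eta by multiples of pi are angle functions too, and zeta stays between the two
    consecutive translates that enclose it at time 0, since the order of angles persists. *)
Lemma angle_diff_bounded (q eta zeta : R -> R) (M : R) :
  (forall t, Rabs (q t) <= M) -> is_angle q eta -> is_angle q zeta ->
  forall t, 0 <= t -> Rabs (zeta t - eta t) <= Rabs (zeta 0 - eta 0) + PI.
Proof.
  intros qb He Hz t Ht.
  destruct (exists_floor_PI (zeta 0 - eta 0)) as [j [Hj1 Hj2]].
  assert (Hs : forall i, is_angle q (fun t => eta (t + 0) + IZR i * PI))
    by (intro i; apply is_angle_shift; [intro; now rewrite Rplus_0_r | exact He]).
  pose proof (angle_le q q _ zeta M qb (fun _ => Rle_refl _) (Hs j) Hz) as L.
  pose proof (angle_le q q zeta _ M qb (fun _ => Rle_refl _) Hz (Hs (j + 1)%Z)) as U.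
  cbv beta in L, U. rewrite Rplus_0_l in L, U. rewrite plus_IZR in U.
  specialize (L ltac:(lra) t Ht). specialize (U ltac:(lra) t Ht).
  rewrite Rplus_0_r in L, U. pose proof PI_RGT_0.
  assert (- Rabs (zeta 0 - eta 0) <= zeta 0 - eta 0 <= Rabs (zeta 0 - eta 0))
    by (apply Rabs_le_between; lra).
  apply Rabs_le_between. lra.
Qed.

(** By periodicity, eta shifted in time by m periods is again an angle function. Trapping it between
    two translates of eta at distance pi shows that eta, sampled at the periods, is additive up to
    pi. *)
Lemma rotation_exists (q : R -> R) (M : R) :
  (forall t, continuous q t) -> (forall t, Rabs (q t) <= M) ->
  (forall t, q (t + 2 * PI) = q t) ->
  exists rho, is_rotation q rho.
Proof.
  intros qc qb qp.
  destruct (angle_exists q M qc qb) as [eta [e0 He]].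
  assert (qpn : forall n t, q (t + 2 * PI * INR n) = q t).
  { induction n as [| n IH]; intro t.
    - simpl. f_equal; ring.
    - rewrite S_INR. replace (t + 2 * PI * (INR n + 1))
        with (t + 2 * PI * INR n + 2 * PI) by ring.
      now rewrite qp. }
  pose proof PI_RGT_0 as P.
  assert (tp : forall n, 0 <= 2 * PI * INR n)
    by (intro n; pose proof (pos_INR n); nra).
  destruct (quasi_additive_lim (fun n => eta (2 * PI * INR n)) PI) as [l Hl].
  { intros m n.
    destruct (exists_floor_PI (eta (2 * PI * INR m))) as [j [Hj1 Hj2]].
    pose proof (is_angle_shift q eta (2 * PI * INR m) 0 (qpn m) He) as Hm.
    assert (Hs : forall i, is_angle q (fun t => eta (t + 0) + IZR i * PI))
      by (intro i; apply is_angle_shift; [intro; now rewrite Rplus_0_r | exact He]).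
    pose proof (angle_le q q _ _ M qb (fun _ => Rle_refl _) (Hs j) Hm) as L.
    pose proof (angle_le q q _ _ M qb (fun _ => Rle_refl _) Hm (Hs (j + 1)%Z)) as U.
    cbv beta in L, U. rewrite !Rplus_0_l, e0, Rmult_0_l in L, U. rewrite plus_IZR in U.
    specialize (L ltac:(lra) _ (tp n)). specialize (U ltac:(lra) _ (tp n)).
    rewrite !Rplus_0_r in L, U.
    replace (2 * PI * INR n + 2 * PI * INR m) with (2 * PI * INR (m + n)) in L, U
      by (rewrite plus_INR; ring).
    apply Rabs_le_between. cbv beta. lra. }
  (* The limit l counts angle per period; the rotation number counts it per unit of time. *)
  exists (l / (2 * PI)). intros zeta Hz.
  apply lim_bounded_diff with (fun k => eta (2 * PI * INR k)) (Rabs (zeta 0 - eta 0) + PI).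
  - intro k. now apply (angle_diff_bounded q eta zeta M).
  - apply is_lim_seq_ext with (fun k => / (2 * PI) * (eta (2 * PI * INR k) / INR k)).
    + intro k. unfold Rdiv. rewrite !Rinv_mult. ring.
    + replace (Finite (l / (2 * PI))) with (Rbar_mult (/ (2 * PI)) l)
        by (simpl; f_equal; field; lra).
      now apply is_lim_seq_scal_l.
Qed.

Lemma rotation_le (q p : R -> R) (M rq rp : R) :
  (forall t, continuous q t) -> (forall t, Rabs (q t) <= M) ->
  (forall t, continuous p t) -> (forall t, Rabs (p t) <= M) ->
  (forall t, q t <= p t) ->
  is_rotation q rq -> is_rotation p rp -> rq <= rp.
Proof.
  intros qc qb pc pb qp Hq Hp.
  destruct (angle_exists q M qc qb) as [eta [e0 He]].
  destruct (angle_exists p M pc pb) as [zeta [z0 Hz]].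
  apply (is_lim_seq_le_loc _ _ _ _) with (2 := Hq eta He) (3 := Hp zeta Hz).
  exists 1%nat. intros k Hk. pose proof PI_RGT_0.
  assert (0 < INR k) by (apply lt_0_INR; lia).
  apply Rmult_le_compat_r; [apply Rlt_le, Rinv_0_lt_compat; nra |].
  apply (angle_le q p eta zeta M qb qp He Hz); [lra | nra].
Qed.

(** * Change of the time variable *)

Lemma continuous_avoids (D : R -> R) (y : R) :
  (forall t, continuous D t) -> (forall t, D t <> y) ->
  D 0 < y -> forall t, D t < y.
Proof.
  intros Dc Dn D0 t.
  destruct (Rlt_le_dec (D t) y) as [H | H]; [exact H | exfalso].
  destruct (IVT_gen D 0 t y) as [s [_ Hs]].
  - intro x. apply continuity_pt_filterlim, Dc.
  - rewrite Rmin_left, Rmax_right by lra. lra.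
  - exact (Dn s Hs).
Qed.

(** A difference of pi or - pi would reverse both sine and cosine. Equal signs of the sines exclude
    this unless both sines vanish, and then the cosines exclude it; so a - b, which starts at 0,
    never reaches either value. *)
Lemma angles_stay_close (a b : R -> R) :
  (forall t, continuous a t) -> (forall t, continuous b t) ->
  (forall t, exists k, 0 < k /\ sin (a t) = k * sin (b t)) ->
  (forall t, sin (b t) = 0 -> 0 < cos (a t) * cos (b t)) ->
  a 0 = b 0 ->
  forall t, Rabs (a t - b t) <= PI.
Proof.
  intros ac bc Hs Hc H0 t. pose proof PI_RGT_0.
  assert (N : forall s e, (e = PI \/ e = - PI) -> a s - b s <> e).
  { intros s e He E.
    assert (T : cos (a s) = - cos (b s) /\ sin (a s) = - sin (b s)).
    { replace (a s) with (b s + e) by lra. rewrite cos_plus, sin_plus.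
      destruct He; subst e; rewrite ?cos_neg, ?sin_neg, cos_PI, sin_PI;
        split; rewrite <- ?E; ring. }
    destruct T as [Tc Ts]. destruct (Hs s) as [k [k0 Hk]].
    rewrite Ts in Hk. assert (S0 : sin (b s) = 0) by nra.
    specialize (Hc s S0). rewrite Tc in Hc. nra. }
  assert (Dc : forall s, continuous (fun s => a s - b s) s)
    by (intro; apply @continuous_minus; auto).
  assert (Dc' : forall s, continuous (fun s => b s - a s) s)
    by (intro; apply @continuous_minus; auto).
  apply Rabs_le. split.
  - cut (b t - a t < PI); [lra |].
    apply (continuous_avoids (fun s => b s - a s) PI Dc'); [| lra].
    intros s E. apply (N s (- PI)); [now right | lra].
  - apply Rlt_le, (continuous_avoids (fun s => a s - b s) PI Dc); [| lra].
    intros s. apply N. now left.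
Qed.

Lemma is_angle_continuous (q eta : R -> R) :
  is_angle q eta -> forall t, continuous eta t.
Proof. intros He t. apply (ex_derive_continuous eta). eexists; apply He. Qed.

(** The rotation number can be read off from a continuous function that does not solve the angle
    equation, provided it reproduces the signs of u everywhere and the sign of v at the zeros of u.
    This serves for explicit solutions and for solutions transported by a change of time. *)
Lemma rotation_of_solution (q u v eta : R -> R) (M rho : R) :
  (forall t, continuous q t) -> (forall t, Rabs (q t) <= M) ->
  is_rotation q rho -> is_solution q u v -> u 0 = 0 -> 0 < v 0 ->
  (forall t, continuous eta t) -> eta 0 = 0 ->
  (forall t, exists k, 0 < k /\ u t = k * sin (eta t)) ->
  (forall t, sin (eta t) = 0 -> 0 < v t * cos (eta t)) ->
  is_lim_seq (fun k => eta (2 * PI * INR k) / (2 * PI * INR k)) rho.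
Proof.
  intros qc qb Hrho Hsol u0 v0 ec e0 Hu Hv.
  assert (P0 : 0 < v 0 ^ 2 + u 0 ^ 2) by (rewrite u0; nra).
  assert (E : sqrt (v 0 ^ 2 + u 0 ^ 2) = v 0).
  { rewrite u0. replace (v 0 ^ 2 + 0 ^ 2) with (v 0 ^ 2) by ring.
    apply sqrt_pow2. lra. }
  destruct (angle_of_solution q u v M 0 qc qb Hsol P0) as [a [a0 [Ha Hr]]].
  - rewrite E, cos_0. lra.
  - rewrite E, sin_0. lra.
  - assert (rp : forall t, 0 < sqrt (v t ^ 2 + u t ^ 2))
      by (intro; now apply sqrt_lt_R0, (solution_nonzero q u v M)).
    apply lim_bounded_diff with (fun k => a (2 * PI * INR k)) PI; [| now apply Hrho].
    intro k. rewrite Rabs_minus_sym. apply angles_stay_close; auto.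
    + now apply (is_angle_continuous q).
    + intro t. destruct (Hu t) as [c [c0 Hc]]. destruct (Hr t) as [_ Hs].
      specialize (rp t). exists (c / sqrt (v t ^ 2 + u t ^ 2)). split.
      * now apply Rdiv_lt_0_compat.
      * apply Rmult_eq_reg_l with (sqrt (v t ^ 2 + u t ^ 2)); [| lra].
        rewrite <- Hs. rewrite Hc at 1. field. lra.
    + intros t Ht. specialize (Hv t Ht). destruct (Hr t) as [Hc _].
      specialize (rp t). rewrite Hc in Hv. nra.
    + congruence.
Qed.

Lemma rotation_unique (q : R -> R) (M r1 r2 : R) :
  (forall t, continuous q t) -> (forall t, Rabs (q t) <= M) ->
  is_rotation q r1 -> is_rotation q r2 -> r1 = r2.
Proof.
  intros qc qb H1 H2. destruct (angle_exists q M qc qb) as [eta [_ He]].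
  pose proof (is_lim_seq_unique _ _ (H1 eta He)).
  pose proof (is_lim_seq_unique _ _ (H2 eta He)). congruence.
Qed.

(** The phase m t is in general not the polar angle of (cos(m t), sin(m t) / m), but it has the same
    sign pattern, and that is enough. *)
Lemma rotation_const (q : R -> R) (m : R) :
  0 < m -> (forall t, q t = m ^ 2) -> is_rotation q m.
Proof.
  intros m0 Hq.
  assert (qc : forall t, continuous q t).
  { intro t. apply continuous_ext with (fun _ => m ^ 2);
      [intro; now rewrite Hq | apply continuous_const]. }
  assert (qb : forall t, Rabs (q t) <= m ^ 2)
    by (intro; rewrite Hq, Rabs_pos_eq; [lra | apply pow2_ge_0]).
  destruct (rotation_exists q (m ^ 2) qc qb) as [rho Hrho];
    [intro; now rewrite !Hq |].
  replace m with rho; [exact Hrho |].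
  assert (L : is_lim_seq (fun k => m * (2 * PI * INR k) / (2 * PI * INR k)) rho).
  { apply (rotation_of_solution q (fun t => sin (m * t) / m) (fun t => cos (m * t))
             (fun t => m * t) (m ^ 2) rho qc qb Hrho).
    - split; intro t; rewrite ?Hq; auto_derive; auto; field; lra.
    - rewrite Rmult_0_r, sin_0. field. lra.
    - rewrite Rmult_0_r, cos_0. lra.
    - intro t. apply (ex_derive_continuous (fun t => m * t)). auto_derive; auto.
    - ring.
    - intro t. exists (/ m). split; [now apply Rinv_0_lt_compat |]. field. lra.
    - intros t Ht. pose proof (sin2_cos2_pow (m * t)) as E. rewrite Ht in E. lra. }
  assert (L' : is_lim_seq (fun k => m * (2 * PI * INR k) / (2 * PI * INR k)) m).
  { apply is_lim_seq_ext_loc with (fun _ => m); [| apply is_lim_seq_const].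
    exists 1%nat. intros k Hk. pose proof PI_RGT_0.
    assert (0 < INR k) by (apply lt_0_INR; lia). field. lra. }
  apply is_lim_seq_unique in L. apply is_lim_seq_unique in L'. congruence.
Qed.

(* Liouville's transformation: if [u'' = - q u] and [phi' = 1 / D], then
   [y := sqrt D * (u o phi)] satisfies [y'' = - p y]. *)
Lemma rotation_change_of_time (q p phi D D1 D2 : R -> R) (M rho : R) :
  (forall t, continuous q t) -> (forall t, Rabs (q t) <= M) ->
  (forall t, continuous p t) -> (forall t, Rabs (p t) <= M) ->
  (forall t, p (t + 2 * PI) = p t) ->
  (forall t, 0 < D t) -> (forall t, is_derive D t (D1 t)) ->
  (forall t, is_derive D1 t (D2 t)) -> (forall t, is_derive phi t (/ D t)) ->
  (forall k : nat, phi (2 * PI * INR k) = 2 * PI * INR k) ->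
  (forall t, p t = q (phi t) / D t ^ 2 - D2 t / (2 * D t) + D1 t ^ 2 / (4 * D t ^ 2)) ->
  is_rotation q rho -> is_rotation p rho.
Proof.
  intros qc qb pc pb pp HD HD1 HD2 Hphi phik Hp Hrho.
  assert (phi0 : phi 0 = 0)
    by (generalize (phik O); simpl; now rewrite Rmult_0_r).
  destruct (rotation_exists p M pc pb pp) as [rho' Hrho'].
  replace rho with rho'; [exact Hrho' |].
  destruct (linear_solution_exists q M qc qb 0 1) as [u [v [u0 [v0 [Hu Hv]]]]].
  assert (E : v 0 ^ 2 + u 0 ^ 2 = 1) by (rewrite u0, v0; ring).
  assert (P0 : 0 < v 0 ^ 2 + u 0 ^ 2) by lra.
  destruct (angle_of_solution q u v M 0 qc qb (conj Hu Hv) P0) as [eta [e0 [He Hr]]].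
  { rewrite E, cos_0, sqrt_1. lra. }
  { rewrite sin_0, u0. ring. }
  assert (rp : forall t, 0 < sqrt (v t ^ 2 + u t ^ 2))
    by (intro; now apply sqrt_lt_R0, (solution_nonzero q u v M)).
  set (s := fun t => sqrt (D t)).
  assert (sp : forall t, 0 < s t) by (intro; apply sqrt_lt_R0, HD).
  assert (ss : forall t, D t = s t * s t)
    by (intro; symmetry; apply sqrt_sqrt, Rlt_le, HD).
  assert (Hsd : forall t, is_derive s t (D1 t / (2 * s t)))
    by (intro; apply (is_derive_sqrt D); [apply HD1 | apply HD]).
  clearbody s.
  assert (L : is_lim_seq (fun k => eta (phi (2 * PI * INR k)) / (2 * PI * INR k)) rho').
  (* The second function is y' for y = sqrt D (u o phi). At a zero of u o phi only (v o phi) / sqrt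
     D remains of it, so eta o phi has the sign pattern of (y', y). *)
  { apply (rotation_of_solution p (fun t => u (phi t) * s t)
      (fun t => (v (phi t) + u (phi t) * D1 t / 2) / s t)
      (fun t => eta (phi t)) M rho' pc pb Hrho').
    - assert (ex : forall t, ex_derive phi t /\ ex_derive s t /\ ex_derive D1 t /\
          ex_derive u (phi t) /\ ex_derive v (phi t)).
      { intro t. split; [| split; [| split; [| split]]]; eexists;
          [apply Hphi | apply Hsd | apply HD2 | apply Hu | apply Hv]. }
      assert (Du : forall t, Derive (fun x => u x) t = v t)
        by (intro; apply is_derive_unique, Hu).
      assert (Dv : forall t, Derive (fun x => v x) t = - q t * u t)
        by (intro; apply is_derive_unique, Hv).
      assert (Ds : forall t, Derive (fun x => s x) t = D1 t / (2 * s t))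
        by (intro; apply is_derive_unique, Hsd).
      assert (DD : forall t, Derive (fun x => D1 x) t = D2 t)
        by (intro; apply is_derive_unique, HD2).
      assert (Dp : forall t, Derive (fun x => phi x) t = / D t)
        by (intro; apply is_derive_unique, Hphi).
      split; intro t; destruct (ex t) as [x1 [x2 [x3 [x4 x5]]]];
        specialize (sp t); auto_derive; try (repeat split; auto; lra).
      + rewrite Du, Ds, Dp, ss. field. lra.
      + rewrite Du, Dv, Ds, Dp, DD, Hp, ss. field. lra.
    - rewrite phi0, u0. ring.
    - rewrite phi0, u0, v0. apply Rdiv_lt_0_compat; [lra | apply sp].
    - intro t. apply (continuous_comp phi eta).
      + apply (ex_derive_continuous phi). eexists; apply Hphi.
      + now apply (is_angle_continuous q).
    - now rewrite phi0.
    - intro t. destruct (Hr (phi t)) as [_ Hs].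
      exists (sqrt (v (phi t) ^ 2 + u (phi t) ^ 2) * s t). split.
      + now apply Rmult_lt_0_compat.
      + rewrite Hs at 1. ring.
    - intros t Ht. destruct (Hr (phi t)) as [Hc Hs].
      rewrite Ht, Rmult_0_r in Hs.
      specialize (rp (phi t)). specialize (sp t).
      pose proof (sin2_cos2_pow (eta (phi t))) as T. rewrite Ht in T.
      set (r := sqrt (v (phi t) ^ 2 + u (phi t) ^ 2)) in *. rewrite Hs, Hc.
      replace ((r * cos (eta (phi t)) + 0 * D1 t / 2) / s t * cos (eta (phi t)))
        with (r / s t * cos (eta (phi t)) ^ 2) by (field; lra).
      replace (cos (eta (phi t)) ^ 2) with 1 by lra.
      rewrite Rmult_1_r. now apply Rdiv_lt_0_compat. }
  (* Since phi fixes every 2 pi k, the sequence just treated for p is the one whose limit is the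
     rotation number of q. *)
  pose proof (Hrho eta He) as L'.
  apply is_lim_seq_ext with (v := fun k => eta (2 * PI * INR k) / (2 * PI * INR k)) in L;
    [| intro; now rewrite phik].
  apply is_lim_seq_unique in L. apply is_lim_seq_unique in L'. congruence.
Qed.

(** * The Moebius change of time and the Euler orbit *)

(** The subtraction formula for tan((phi - t) / 2), with tan(phi/2) = l tan(t/2), gives the argument
    of [atan]. Its denominator is positive for l > 0, so the formula is smooth on the whole line and
    no branch has to be chosen. *)
Definition mobius_lift (l t : R) : R :=
  t + 2 * atan ((l - 1) * sin t / ((1 + l) + (1 - l) * cos t)).

(** For l = exp s and c = cos t these two functions D and N are cosh s - c sinh s and c cosh s -
    sinh s; the lift phi satisfies phi' = 1 / D and cos phi = N / D. *)
Definition mobius_density (l c : R) : R := ((1 + c) / l + l * (1 - c)) / 2.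
Definition mobius_cos_num (l c : R) : R := ((1 + c) / l - l * (1 - c)) / 2.

Lemma mobius_density_pos (l c : R) : 0 < l -> -1 <= c <= 1 -> 0 < mobius_density l c.
Proof.
  intros Hl Hc. unfold mobius_density.
  assert (0 < / l) by now apply Rinv_0_lt_compat.
  unfold Rdiv. destruct (Req_dec c 1) as [-> | H1]; nra.
Qed.

Lemma mobius_cos_num_le (l c : R) : 0 < l -> -1 <= c <= 1 ->
  - mobius_density l c <= mobius_cos_num l c <= mobius_density l c.
Proof.
  intros Hl Hc. unfold mobius_density, mobius_cos_num.
  assert (0 < / l) by now apply Rinv_0_lt_compat.
  unfold Rdiv. split; nra.
Qed.

Lemma mobius_denominator_pos (l t : R) : 0 < l -> 0 < (1 + l) + (1 - l) * cos t.
Proof.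
  intro Hl. pose proof (COS_bound t).
  replace ((1 + l) + (1 - l) * cos t) with ((1 + cos t) + l * (1 - cos t)) by ring.
  destruct (Req_dec (cos t) 1) as [-> | H1]; nra.
Qed.

Lemma mobius_lift_derive (l t : R) : 0 < l ->
  is_derive (mobius_lift l) t (/ mobius_density l (cos t)).
Proof.
  intro Hl. pose proof (mobius_denominator_pos l t Hl) as HU.
  pose proof (mobius_density_pos l (cos t) Hl (COS_bound t)) as HD.
  unfold mobius_lift. auto_derive; [lra |].
  assert (S : sin t * sin t = 1 - cos t * cos t)
    by (pose proof (sin2_cos2_pow t); lra).
  set (c := cos t) in *. set (s := sin t) in *.
  set (U := 1 + l + (1 - l) * c) in *.
  (* With z the argument of [atan], this identity reads 1 + z^2 = 4 l D / U^2, which brings in the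
     density. *)
  assert (HT : U * U + (l - 1) * (l - 1) * (s * s) = 4 * l * mobius_density l c)
    by (rewrite S; unfold U, mobius_density; field; lra).
  assert (HP : 0 < U * U + (l - 1) * (l - 1) * (s * s)) by (rewrite HT; nra).
  replace (1 + (l - 1) * s * / U * ((l - 1) * s * / U * 1))
    with (4 * l * mobius_density l c / (U * U)) by (rewrite <- HT; field; lra).
  replace (1 + 2 * (((l - 1) * (1 * c) * / U +
      (l - 1) * s * (- ((1 - l) * (1 * - s)) * / (U * U))) *
      / (4 * l * mobius_density l c / (U * U))))
    with (1 + (l - 1) * (c * U + (1 - l) * (s * s)) / (2 * l * mobius_density l c))
    by (field; lra).
  rewrite S.
  replace (1 + (l - 1) * (c * U + (1 - l) * (1 - c * c)) / (2 * l * mobius_density l c))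
    with ((2 * l * mobius_density l c + (l - 1) * (c * U + (1 - l) * (1 - c * c)))
          / (2 * l * mobius_density l c)) by (field; lra).
  replace (2 * l * mobius_density l c + (l - 1) * (c * U + (1 - l) * (1 - c * c)))
    with (2 * l) by (unfold U, mobius_density; field; lra).
  field. lra.
Qed.

Lemma cos_mobius_lift (l t : R) : 0 < l ->
  cos (mobius_lift l t) = mobius_cos_num l (cos t) / mobius_density l (cos t).
Proof.
  intro Hl. pose proof (mobius_denominator_pos l t Hl) as HU.
  pose proof (mobius_density_pos l (cos t) Hl (COS_bound t)) as HD.
  assert (S : sin t ^ 2 = 1 - cos t ^ 2)
    by (pose proof (sin2_cos2_pow t); lra).
  (* The tangent half-angle formulas make cos phi a rational function of cos t and sin t. *)
  assert (A : forall z, cos (2 * atan z) = (1 - z ^ 2) / (1 + z ^ 2) /\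
                        sin (2 * atan z) = 2 * z / (1 + z ^ 2)).
  { intro z. rewrite cos_2a, sin_2a, cos_atan, sin_atan.
    assert (P : 0 < 1 + z²) by (unfold Rsqr; nra).
    pose proof (sqrt_sqrt (1 + z²) (Rlt_le _ _ P)) as E.
    pose proof (sqrt_lt_R0 _ P) as Q.
    replace (1 + z ^ 2) with (sqrt (1 + z²) * sqrt (1 + z²))
      by (rewrite E; unfold Rsqr; ring).
    split; field; lra. }
  unfold mobius_lift. rewrite cos_plus.
  set (U := 1 + l + (1 - l) * cos t) in *.
  destruct (A ((l - 1) * sin t / U)) as [-> ->].
  assert (HT : U ^ 2 + (l - 1) ^ 2 * sin t ^ 2 = 4 * l * mobius_density l (cos t))
    by (rewrite S; unfold U, mobius_density; field; lra).
  replace (1 + ((l - 1) * sin t / U) ^ 2)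
    with (4 * l * mobius_density l (cos t) / U ^ 2)
    by (rewrite <- HT; field; lra).
  replace (cos t * ((1 - ((l - 1) * sin t / U) ^ 2) / (4 * l * mobius_density l (cos t) / U ^ 2))
     - sin t * (2 * ((l - 1) * sin t / U) / (4 * l * mobius_density l (cos t) / U ^ 2)))
    with ((cos t * (U ^ 2 - (l - 1) ^ 2 * sin t ^ 2) - 2 * (l - 1) * U * sin t ^ 2)
          / (4 * l * mobius_density l (cos t))) by (field; lra).
  rewrite S. apply Rmult_eq_reg_r with (mobius_density l (cos t)); [| lra].
  replace (mobius_cos_num l (cos t) / mobius_density l (cos t) * mobius_density l (cos t))
    with (mobius_cos_num l (cos t)) by (field; lra).
  unfold mobius_cos_num, U. unfold mobius_density in *. field.
  split; [lra |].
  replace (1 + cos t + l * (1 - cos t) * l)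
    with (2 * l * (((1 + cos t) / l + l * (1 - cos t)) / 2)) by (field; lra).
  nra.
Qed.

Lemma cos_sin_period (t : R) : cos (t + 2 * PI) = cos t /\ sin (t + 2 * PI) = sin t.
Proof.
  rewrite cos_plus, sin_plus, cos_2PI, sin_2PI. split; ring.
Qed.

Lemma mobius_lift_period (l : R) (k : nat) :
  mobius_lift l (2 * PI * INR k) = 2 * PI * INR k.
Proof.
  unfold mobius_lift.
  assert (S : sin (2 * PI * INR k) = 0).
  { apply sin_eq_0_1. exists (2 * Z.of_nat k)%Z.
    rewrite mult_IZR, <- INR_IZR_INZ. ring. }
  rewrite S, Rmult_0_r. unfold Rdiv. rewrite Rmult_0_l, atan_0. ring.
Qed.

(* The exponent makes the linear terms in [c] cancel in the derivative with
   respect to [e] of [euler_potential]. *)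
Definition mobius_exponent (B : R) : R := B / (2 * B + 3 / 2).

Definition mobius_factor (B e : R) : R := exp (mobius_exponent B * e).

(* Potential of the Hill equation in the new time [t], with [c = cos t]. *)
Definition euler_potential (B e c : R) : R :=
  let D := mobius_density (mobius_factor B e) c in
  let N := mobius_cos_num (mobius_factor B e) c in
  1 / 4 + 3 / 4 / D ^ 2 + B / (D * (D + e * N)).

Lemma euler_potential_0 (B c : R) : euler_potential B 0 c = 1 + B.
Proof.
  unfold euler_potential, mobius_factor, mobius_density, mobius_cos_num.
  rewrite Rmult_0_r, exp_0. field. lra.
Qed.

Lemma exp_le_compat (x y : R) : x <= y -> exp x <= exp y.
Proof.
  intros [H | ->]; [apply Rlt_le, exp_increasing, H | apply Rle_refl].
Qed.

(** One estimate serves both claims: any e1 <= e2 gives monotonicity, and e1 = 0 gives a gap kappa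
    e2^2 that does not depend on the angle. *)
Lemma euler_potential_incr (B : R) : 0 < B ->
  exists kappa, 0 < kappa /\
  forall e1 e2 c, 0 <= e1 -> e1 <= e2 -> e2 < 1 -> -1 <= c <= 1 ->
    euler_potential B e1 c + kappa * (e2 ^ 2 - e1 ^ 2) <= euler_potential B e2 c.
Proof.
  intro HB. set (a := mobius_exponent B).
  assert (Ha : 0 < a) by (apply Rdiv_lt_0_compat; lra).
  (* Chosen so that 2 kappa e is the lower bound a e B / (4 exp(a)^2) of the derivative. It comes
     from D + e N <= 2 D <= 2 exp a after dropping all summands of the numerator but B D^3. *)
  set (kappa := a * B / (8 * exp a ^ 2)).
  assert (Ea : 0 < exp a) by apply exp_pos.
  exists kappa. split; [apply Rdiv_lt_0_compat; nra |].
  intros e1 e2 c He1 He12 He2 Hc.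
  set (D := fun e => mobius_density (exp (a * e)) c).
  set (N := fun e => mobius_cos_num (exp (a * e)) c).
  assert (HD : forall e, 0 < D e) by (intro; now apply mobius_density_pos; [apply exp_pos |]).
  assert (HN : forall e, - D e <= N e <= D e)
    by (intro; now apply mobius_cos_num_le; [apply exp_pos |]).
  assert (DD : forall e, is_derive D e (- a * N e)).
  { intro e. unfold D, N, mobius_density, mobius_cos_num. pose proof (exp_pos (a * e)).
    auto_derive; [lra | field; lra]. }
  assert (DN : forall e, is_derive N e (- a * D e)).
  { intro e. unfold D, N, mobius_density, mobius_cos_num. pose proof (exp_pos (a * e)).
    auto_derive; [lra | field; lra]. }
  assert (Dle : forall e, 0 <= e < 1 -> D e <= exp a).
  { intros e He. unfold D, mobius_density.
    assert (1 <= exp (a * e)) by (rewrite <- exp_0; apply exp_le_compat; nra).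
    assert (exp (a * e) <= exp a) by (apply exp_le_compat; nra).
    assert (/ exp (a * e) <= 1) by (rewrite <- Rinv_1; apply Rinv_le_contravar; lra).
    unfold Rdiv. nra. }
  assert (HDN : forall e, 0 <= e < 1 -> 0 < D e + e * N e <= 2 * D e).
  { intros e He. specialize (HD e). specialize (HN e). split; nra. }
  (* Subtracting kappa e^2 on both sides turns the quantitative claim into monotonicity of one
     function of e. *)
  enough (H : (1 / 4 + 3 / 4 / D e1 ^ 2 + B / (D e1 * (D e1 + e1 * N e1))) - kappa * e1 ^ 2
           <= (1 / 4 + 3 / 4 / D e2 ^ 2 + B / (D e2 * (D e2 + e2 * N e2))) - kappa * e2 ^ 2).
  { unfold euler_potential, mobius_factor. fold a. unfold D, N in H. lra. }
  clearbody D N.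
  apply (nonneg_derive_le
    (fun e => (1 / 4 + 3 / 4 / D e ^ 2 + B / (D e * (D e + e * N e))) - kappa * e ^ 2)
    (fun e => a * e * (B * D e * (N e ^ 2 + D e ^ 2) + 3 * N e ^ 2 * (D e + e * N e / 2))
              / (D e ^ 3 * (D e + e * N e) ^ 2) - 2 * kappa * e)); [exact He12 | |].
  - intros e He. specialize (HDN e ltac:(lra)). specialize (HD e).
    assert (X : ex_derive D e /\ ex_derive N e)
      by (split; eexists; [apply DD | apply DN]).
    destruct X as [X1 X2].
    auto_derive.
    + repeat split; auto; simpl; apply Rgt_not_eq; nra.
    + replace (Derive (fun x => D x) e) with (- a * N e)
        by (symmetry; apply is_derive_unique, DD).
      replace (Derive (fun x => N x) e) with (- a * D e)
        by (symmetry; apply is_derive_unique, DN).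
      (* The explicit value is needed here: the terms in N D^2 have total coefficient B (2 a - 1) +
         3 a / 2, which is zero for this a only. *)
      change a with (B / (2 * B + 3 / 2)). simpl pred. field.
      repeat split; lra.
  - intros e He. specialize (HDN e ltac:(lra)). specialize (HD e).
    specialize (HN e). specialize (Dle e ltac:(lra)).
    set (V := D e + e * N e) in *.
    set (X := B * D e * (N e ^ 2 + D e ^ 2) + 3 * N e ^ 2 * (D e + e * N e / 2)).
    assert (D3 : 0 < D e ^ 3) by now apply pow_lt.
    assert (HX : B * D e ^ 3 <= X).
    { assert (0 <= N e ^ 2) by apply pow2_ge_0.
      assert (0 <= D e + e * N e / 2) by (unfold V in HDN; lra).
      assert (0 <= B * D e) by nra.
      assert (0 <= B * D e * N e ^ 2) by now apply Rmult_le_pos.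
      assert (0 <= N e ^ 2 * (D e + e * N e / 2)) by now apply Rmult_le_pos.
      unfold X. lra. }
    assert (HV : V ^ 2 <= 4 * exp a ^ 2).
    { replace (4 * exp a ^ 2) with ((2 * exp a) ^ 2) by ring.
      apply pow_incr. lra. }
    assert (V2 : 0 < V ^ 2) by (apply pow_lt; lra).
    assert (HXV : B / (4 * exp a ^ 2) <= X / (D e ^ 3 * V ^ 2)).
    { apply Rle_trans with (B / V ^ 2).
      - apply Rmult_le_compat_l; [lra |]. now apply Rinv_le_contravar.
      - replace (B / V ^ 2) with (B * D e ^ 3 / (D e ^ 3 * V ^ 2)) by (field; lra).
        apply Rmult_le_compat_r; [| exact HX].
        apply Rlt_le, Rinv_0_lt_compat, Rmult_lt_0_compat; assumption. }
    replace (a * e * X / (D e ^ 3 * V ^ 2) - 2 * kappa * e)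
      with (a * e * (X / (D e ^ 3 * V ^ 2) - B / (4 * exp a ^ 2)))
      by (unfold kappa; field; repeat split; lra).
    apply Rmult_le_pos; [apply Rmult_le_pos; lra | lra].
Qed.

(** * Regularity of both potentials and equality of their rotation numbers *)

Lemma hill_coefficient_continuous (beta e t : R) : 0 <= e < 1 ->
  continuous (hill_coefficient beta e) t.
Proof.
  intro He. pose proof (COS_bound t).
  apply (ex_derive_continuous (hill_coefficient beta e)).
  unfold hill_coefficient. auto_derive. nra.
Qed.

Lemma hill_coefficient_bound (beta e t : R) : 0 < beta -> 0 <= e < 1 ->
  Rabs (hill_coefficient beta e t) <= 1 + 7 * beta / (1 - e).
Proof.
  intros Hb He. pose proof (COS_bound t). unfold hill_coefficient.
  assert (H1 : 1 - e <= 1 + e * cos t) by nra.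
  assert (H2 : 0 < 7 * beta / (1 + e * cos t)) by (apply Rdiv_lt_0_compat; lra).
  rewrite Rabs_pos_eq by lra.
  apply Rplus_le_compat_l, Rmult_le_compat_l; [lra |].
  apply Rinv_le_contravar; lra.
Qed.

Lemma hill_coefficient_period (beta e t : R) :
  hill_coefficient beta e (t + 2 * PI) = hill_coefficient beta e t.
Proof. unfold hill_coefficient. now rewrite (proj1 (cos_sin_period t)). Qed.

Section EulerPotential.

Variables (B e : R).
Hypothesis HB : 0 < B.
Hypothesis He : 0 <= e < 1.

Let l := mobius_factor B e.

Lemma mobius_denominators_pos (c : R) : -1 <= c <= 1 ->
  0 < mobius_density l c /\ 0 < mobius_density l c + e * mobius_cos_num l c.
Proof.
  intro Hc. assert (l0 : 0 < l) by apply exp_pos.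
  pose proof (mobius_density_pos l c l0 Hc).
  pose proof (mobius_cos_num_le l c l0 Hc). split; [assumption | nra].
Qed.

Lemma euler_potential_continuous (t : R) :
  continuous (fun t => euler_potential B e (cos t)) t.
Proof.
  apply (ex_derive_continuous (fun t => euler_potential B e (cos t))).
  pose proof (mobius_denominators_pos (cos t) (COS_bound t)) as [H1 H2].
  unfold euler_potential. fold l.
  unfold mobius_density, mobius_cos_num in *.
  assert (l0 : 0 < l) by apply exp_pos.
  auto_derive. simpl. unfold Rdiv, Rminus in *.
  repeat split; try lra; apply Rgt_not_eq; try apply Rmult_lt_0_compat; lra.
Qed.

Lemma euler_potential_bounded :
  exists M, forall t, Rabs (euler_potential B e (cos t)) <= M.
Proof.
  assert (l1 : 1 <= l).
  { unfold l, mobius_factor. rewrite <- exp_0. apply exp_le_compat.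
    assert (0 < mobius_exponent B) by (apply Rdiv_lt_0_compat; lra). nra. }
  exists (1 / 4 + 3 / 4 / (/ l) ^ 2 + B / (/ l * ((1 - e) / l))).
  intro t. pose proof (COS_bound t) as Hc.
  pose proof (mobius_denominators_pos (cos t) Hc) as [HD HDN].
  assert (I0 : 0 < / l) by (apply Rinv_0_lt_compat; lra).
  assert (Il : / l <= 1) by (rewrite <- Rinv_1; apply Rinv_le_contravar; lra).
  assert (D1 : / l <= mobius_density l (cos t))
    by (unfold mobius_density, Rdiv; nra).
  (* D + e N is the sum of (1 + e)(1 + c) / (2 l) and (1 - e) l (1 - c) / 2. Both weights 1 + e and
     1 - e are at least 1 - e, both l and 1 / l are at least 1 / l, and (1 + c) + (1 - c) = 2. *)
  assert (D2 : (1 - e) / l <= mobius_density l (cos t) + e * mobius_cos_num l (cos t)).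
  { replace (mobius_density l (cos t) + e * mobius_cos_num l (cos t))
      with ((1 + e) * ((1 + cos t) * / l) / 2 + (1 - e) * (l * (1 - cos t)) / 2)
      by (unfold mobius_density, mobius_cos_num; field; lra).
    assert (0 <= (1 + cos t) * / l) by (apply Rmult_le_pos; lra).
    assert (Hle : (1 - e) * ((1 - cos t) * / l) <= (1 - e) * (l * (1 - cos t))).
    { apply Rmult_le_compat_l; [lra |]. nra. }
    unfold Rdiv in *. nra. }
  unfold euler_potential. fold l.
  set (D := mobius_density l (cos t)) in *.
  set (N := mobius_cos_num l (cos t)) in *.
  assert (P2 : 0 < (/ l) ^ 2) by now apply pow_lt.
  assert (E0 : 0 < (1 - e) / l) by (apply Rdiv_lt_0_compat; lra).
  rewrite Rabs_pos_eq.
  - apply Rplus_le_compat; [apply Rplus_le_compat_l |].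
    + apply Rmult_le_compat_l; [lra |]. apply Rinv_le_contravar; [exact P2 |].
      apply pow_incr. lra.
    + apply Rmult_le_compat_l; [lra |]. apply Rinv_le_contravar.
      * now apply Rmult_lt_0_compat.
      * apply Rmult_le_compat; lra.
  - assert (0 < 3 / 4 / D ^ 2) by (apply Rdiv_lt_0_compat; [lra | now apply pow_lt]).
    assert (0 < B / (D * (D + e * N)))
      by (apply Rdiv_lt_0_compat; [lra | now apply Rmult_lt_0_compat]).
    lra.
Qed.

End EulerPotential.

Lemma rotation_euler_potential (beta e rho : R) : 0 < beta -> 0 <= e < 1 ->
  is_rotation (hill_coefficient beta e) rho ->
  is_rotation (fun t => euler_potential (7 * beta) e (cos t)) rho.
Proof.
  intros Hb He Hrho. assert (HB : 0 < 7 * beta) by lra.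
  destruct (euler_potential_bounded (7 * beta) e HB He) as [M1 HM1].
  set (M2 := 1 + 7 * beta / (1 - e)).
  set (l := mobius_factor (7 * beta) e).
  assert (l0 : 0 < l) by apply exp_pos.
  apply (rotation_change_of_time (hill_coefficient beta e) _ (mobius_lift l)
    (fun t => mobius_density l (cos t)) (fun t => (l - / l) / 2 * sin t)
    (fun t => (l - / l) / 2 * cos t) (Rmax M1 M2)).
  - intro. now apply hill_coefficient_continuous.
  - intro. eapply Rle_trans; [now apply hill_coefficient_bound | apply Rmax_r].
  - intro. now apply euler_potential_continuous.
  - intro. eapply Rle_trans; [apply HM1 | apply Rmax_l].
  - intro. now rewrite (proj1 (cos_sin_period t)).
  - intro. apply mobius_density_pos; [exact l0 | apply COS_bound].
  - intro t. unfold mobius_density. auto_derive; [lra | field; lra].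
  - intro t. auto_derive; [easy | field; lra].
  - intro. now apply mobius_lift_derive.
  - intro. apply mobius_lift_period.
  - intro t. unfold hill_coefficient. rewrite cos_mobius_lift by exact l0.
    destruct (mobius_denominators_pos (7 * beta) e He (cos t) (COS_bound t)) as [HD HDN].
    unfold euler_potential. fold l in HD, HDN |- *.
    (* The Schwarzian identity {phi, t} = (1 - phi'^2) / 2 written for D = 1 / phi' and cleared of
       denominators; the leading 1 on the right is the constant part of the Hill coefficient. *)
    assert (HDD : mobius_density l (cos t) ^ 2 / 4 + 3 / 4
       = 1 - (l - / l) / 2 * cos t * mobius_density l (cos t) / 2
           + ((l - / l) / 2 * sin t) ^ 2 / 4).
    { replace (((l - / l) / 2 * sin t) ^ 2) with (((l - / l) / 2) ^ 2 * (1 - cos t ^ 2)).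
      - unfold mobius_density. field. lra.
      - pose proof (sin2_cos2_pow t) as S.
        replace (1 - cos t ^ 2) with (sin t ^ 2) by lra. ring. }
    set (D := mobius_density l (cos t)) in *.
    set (N := mobius_cos_num l (cos t)) in *.
    set (D2 := (l - / l) / 2 * cos t) in *.
    set (D1 := (l - / l) / 2 * sin t) in *.
    replace (1 / 4 + 3 / 4 / D ^ 2) with ((D ^ 2 / 4 + 3 / 4) / D ^ 2) by (field; lra).
    rewrite HDD. field. split; lra.
  - exact Hrho.
Qed.

(** * From the matrix flow and continuous arguments to angle functions *)

Lemma entry_hill_field (q : R) (g : mat2) (j : nat) : (j < 2)%nat ->
  entry (Mmult (Mmult J2 (mk_mat2 1 0 0 q)) g) 0 j = - q * entry g 1 j /\
  entry (Mmult (Mmult J2 (mk_mat2 1 0 0 q)) g) 1 j = entry g 0 j.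
Proof.
  intro Hj. destruct g as [[a [b []]] [[c [d []]] []]].
  destruct j as [| [| j]]; [| | lia];
    unfold entry, Mmult, sum_n, sum_n_m, Iter.iter_nat, coeff_mat; simpl;
    unfold plus, mult, zero; simpl; split; ring.
Qed.

Lemma fundamental_solution_exists (beta e : R) : 0 < beta -> 0 <= e < 1 ->
  exists gamma, is_fundamental_solution beta e gamma.
Proof.
  intros Hb He.
  assert (qc : forall t, continuous (hill_coefficient beta e) t)
    by (intro; now apply hill_coefficient_continuous).
  assert (qb : forall t, Rabs (hill_coefficient beta e t) <= 1 + 7 * beta / (1 - e))
    by (intro; now apply hill_coefficient_bound).
  (* Position is the second coordinate, so the first column (1, 0) of the identity means u(0) = 0
     and v(0) = 1. *)
  destruct (linear_solution_exists _ _ qc qb 0 1) as [u1 [v1 [u10 [v10 [Hu1 Hv1]]]]].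
  destruct (linear_solution_exists _ _ qc qb 1 0) as [u2 [v2 [u20 [v20 [Hu2 Hv2]]]]].
  exists (fun t => mk_mat2 (v1 t) (v2 t) (u1 t) (u2 t)). split.
  - rewrite u10, v10, u20, v20. reflexivity.
  - intros t i j Hi Hj.
    destruct (entry_hill_field (hill_coefficient beta e t)
                (mk_mat2 (v1 t) (v2 t) (u1 t) (u2 t)) j Hj) as [E0 E1].
    destruct i as [| [| i]]; [rewrite E0 | rewrite E1 | lia];
      (destruct j as [| [| j]]; [| | lia]); unfold entry, coeff_mat; simpl;
      [apply Hv1 | apply Hv2 | apply Hu1 | apply Hu2].
Qed.

Lemma is_derive_lin_comb (f g : R -> R) (x y t f' g' : R) :
  is_derive f t f' -> is_derive g t g' ->
  is_derive (fun s => f s * x + g s * y) t (f' * x + g' * y).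
Proof.
  intros Hf Hg. auto_derive.
  - split; [exists f'; exact Hf | split; [exists g'; exact Hg | easy]].
  - replace (Derive (fun s => f s) t) with f' by (symmetry; now apply is_derive_unique).
    replace (Derive (fun s => g s) t) with g' by (symmetry; now apply is_derive_unique).
    ring.
Qed.

Lemma mat2_act_solution (beta e : R) (gamma : R -> mat2) (v : C) :
  is_fundamental_solution beta e gamma ->
  mat2_act (gamma 0) v = v /\
  is_solution (hill_coefficient beta e)
    (fun t => snd (mat2_act (gamma t) v)) (fun t => fst (mat2_act (gamma t) v)).
Proof.
  intros [H0 Hd]. split.
  - rewrite H0. unfold mat2_act, entry, coeff_mat. simpl.
    destruct v as [x y]. simpl. unfold one, zero; simpl. f_equal; ring.
  - assert (D : forall t i j, (i < 2)%nat -> (j < 2)%nat ->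
      is_derive (fun t => entry (gamma t) i j) t
       (match i with O => - hill_coefficient beta e t * entry (gamma t) 1 j
                | _ => entry (gamma t) 0 j end)).
    { intros t i j Hi Hj.
      destruct (entry_hill_field (hill_coefficient beta e t) (gamma t) j Hj) as [E0 E1].
      specialize (Hd t i j Hi Hj).
      destruct i as [| [| i]]; [now rewrite E0 in Hd | now rewrite E1 in Hd | lia]. }
    assert (L : forall t i, (i < 2)%nat -> is_derive
      (fun t => entry (gamma t) i 0 * fst v + entry (gamma t) i 1 * snd v) t
      (match i with
       | O => - hill_coefficient beta e t
                * (entry (gamma t) 1 0 * fst v + entry (gamma t) 1 1 * snd v)
       | _ => entry (gamma t) 0 0 * fst v + entry (gamma t) 0 1 * snd v end)).
    { intros t i Hi.
      pose proof (D t i 0%nat Hi ltac:(lia)) as A.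
      pose proof (D t i 1%nat Hi ltac:(lia)) as B.
      pose proof (is_derive_lin_comb _ _ (fst v) (snd v) _ _ _ A B) as AB.
      destruct i; [| exact AB].
      replace (- hill_coefficient beta e t
                 * (entry (gamma t) 1 0 * fst v + entry (gamma t) 1 1 * snd v))
        with (- hill_coefficient beta e t * entry (gamma t) 1 0 * fst v
              + - hill_coefficient beta e t * entry (gamma t) 1 1 * snd v) by ring.
      exact AB. }
    split; intro t; [apply (L t 1%nat) | apply (L t 0%nat)]; lia.
Qed.

Lemma continuous_argument_iff (w : R -> C) (eta : R -> R) (t : R) :
  w t = Cmult (RtoC (Cmod (w t))) (cos (eta t), sin (eta t)) <->
  fst (w t) = sqrt (fst (w t) ^ 2 + snd (w t) ^ 2) * cos (eta t) /\
  snd (w t) = sqrt (fst (w t) ^ 2 + snd (w t) ^ 2) * sin (eta t).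
Proof.
  unfold Cmod, Cmult, RtoC. simpl fst. simpl snd.
  destruct (w t) as [x y]. simpl fst. simpl snd.
  set (r := sqrt (x ^ 2 + y ^ 2)). split.
  - intro H. injection H as Hx Hy. split.
    + transitivity (r * cos (eta t) - 0 * sin (eta t)); [exact Hx | ring].
    + transitivity (r * sin (eta t) + 0 * cos (eta t)); [exact Hy | ring].
  - intros [Hx Hy]. apply f_equal2.
    + transitivity (r * cos (eta t)); [exact Hx | unfold r; simpl; ring].
    + transitivity (r * sin (eta t)); [exact Hy | unfold r; simpl; ring].
Qed.

Lemma Cnonzero_norm_pos (v : C) : v <> RtoC 0 -> 0 < fst v ^ 2 + snd v ^ 2.
Proof.
  intro Hv. destruct v as [x y]. simpl fst. simpl snd.
  destruct (Req_dec x 0) as [-> | Hx]; [| pose proof (pow2_gt_0 x Hx); pose proof (pow2_ge_0 y); lra].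
  destruct (Req_dec y 0) as [-> | Hy]; [now elim Hv |].
  pose proof (pow2_gt_0 y Hy). lra.
Qed.

(** The definition of the path rotation number admits any continuous argument, whereas [is_rotation]
    speaks of solutions of the angle equation. Both describe the same curve, so they differ by a
    bounded amount. *)
Lemma path_rotation_number_iff (beta e rho r : R) (gamma : R -> mat2) :
  0 < beta -> 0 <= e < 1 -> is_fundamental_solution beta e gamma ->
  is_rotation (hill_coefficient beta e) rho ->
  is_path_rotation_number gamma r <-> r = rho.
Proof.
  intros Hb He Hg Hrho.
  assert (qc : forall t, continuous (hill_coefficient beta e) t)
    by (intro; now apply hill_coefficient_continuous).
  assert (qb : forall t, Rabs (hill_coefficient beta e t) <= 1 + 7 * beta / (1 - e))
    by (intro; now apply hill_coefficient_bound).
  split.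
  (* A single vector determines r; existence, in the other direction, has to treat every nonzero
     vector. *)
  - intro Hr. assert (v1 : RtoC 1 <> RtoC 0) by (intro E; apply RtoC_inj in E; lra).
    destruct (Hr (RtoC 1) v1) as [eta [[ec Ha] Hl]].
    destruct (mat2_act_solution beta e gamma (RtoC 1) Hg) as [A0 Hs].
    pose proof (Cnonzero_norm_pos _ v1) as P0. rewrite <- A0 in P0.
    assert (Ha' := fun t => proj1 (continuous_argument_iff (fun s => mat2_act (gamma s) (RtoC 1)) eta t) (Ha t)).
    destruct (angle_of_solution _ _ _ _ (eta 0) qc qb Hs P0
                (proj1 (Ha' 0)) (proj2 (Ha' 0))) as [zeta [z0 [Hz Hzp]]].
    (* The given argument eta is merely continuous, while zeta solves the angle equation; having
       equal cosine and sine and the same start, they cannot drift apart. *)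
    assert (Same : forall t, cos (zeta t) = cos (eta t) /\ sin (zeta t) = sin (eta t)).
    { intro t. destruct (Ha' t) as [A1 A2]. destruct (Hzp t) as [B1 B2].
      pose proof (sqrt_lt_R0 _ (solution_nonzero _ _ _ _ qb Hs P0 t)) as P.
      cbv beta in *. rewrite A1 in B1 at 1. rewrite A2 in B2 at 1.
      split; symmetry; eapply Rmult_eq_reg_l; eauto; lra. }
    assert (L : is_lim_seq (fun k => zeta (2 * PI * INR k) / (2 * PI * INR k)) r).
    { apply lim_bounded_diff with (fun k => eta (2 * PI * INR k)) PI; [| exact Hl].
      intro k. apply angles_stay_close; auto.
      - now apply (is_angle_continuous (hill_coefficient beta e)).
      - intro t. exists 1. rewrite Rmult_1_l. split; [lra | apply Same].
      - intros t Ht. rewrite (proj1 (Same t)).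
        pose proof (sin2_cos2_pow (eta t)) as T. rewrite Ht in T. lra. }
    apply is_lim_seq_unique in L. pose proof (is_lim_seq_unique _ _ (Hrho zeta Hz)).
    congruence.
  - intros -> v Hv.
    destruct (mat2_act_solution beta e gamma v Hg) as [A0 Hs].
    pose proof (Cnonzero_norm_pos _ Hv) as P0. rewrite <- A0 in P0.
    destruct (polar_exists _ _ P0) as [h [Hc Hsn]].
    destruct (angle_of_solution _ _ _ _ h qc qb Hs P0 Hc Hsn) as [eta [_ [Ha Hp]]].
    exists eta. split; [split |].
    + now apply (is_angle_continuous (hill_coefficient beta e)).
    + intro t. now apply (continuous_argument_iff (fun s => mat2_act (gamma s) v)).
    + now apply Hrho.
Qed.

(** The value of [iota] can be used once the predicate is known to hold for exactly one real: the
    constructed fundamental solution gives existence, and the equivalence, valid for every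
    fundamental solution, gives uniqueness. *)
Lemma euler_rotation_number_eq (beta e : R) : 0 < beta -> 0 <= e < 1 ->
  exists rho, is_rotation (hill_coefficient beta e) rho /\
    euler_rotation_number beta e = rho + 1.
Proof.
  intros Hb He.
  destruct (rotation_exists (hill_coefficient beta e) (1 + 7 * beta / (1 - e)))
    as [rho Hrho].
  - intro; now apply hill_coefficient_continuous.
  - intro; now apply hill_coefficient_bound.
  - apply hill_coefficient_period.
  - exists rho. split; [exact Hrho |].
    apply (iota_unique (V := R_CompleteNormedModule)).
    + intros y [gamma [Hg [r [Hr ->]]]].
      now rewrite (proj1 (path_rotation_number_iff beta e rho r gamma Hb He Hg Hrho) Hr).
    + destruct (fundamental_solution_exists beta e Hb He) as [gamma Hg].
      exists gamma. split; [exact Hg |]. exists rho. split; [| reflexivity].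
      now apply (path_rotation_number_iff beta e rho rho gamma Hb He Hg Hrho).
Qed.

Theorem theorem1p1 :
  (forall beta : R, 0 < beta < 1 ->
     forall e1 e2 : R, 0 <= e1 -> e1 <= e2 -> e2 < 1 ->
       euler_rotation_number beta e1 <= euler_rotation_number beta e2) /\
  (forall beta e : R, 0 < beta < 1 -> 0 < e < 1 ->
     euler_rotation_number beta e > euler_rotation_number beta 0 /\
     euler_rotation_number beta 0 = 1 + sqrt (1 + 7 * beta)).
Proof.
  split.
  - intros beta [Hb _] e1 e2 He1 He12 He2.
    assert (HB : 0 < 7 * beta) by lra.
    assert (I1 : 0 <= e1 < 1) by lra. assert (I2 : 0 <= e2 < 1) by lra.
    destruct (euler_rotation_number_eq beta e1 Hb I1) as [r1 [H1 ->]].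
    destruct (euler_rotation_number_eq beta e2 Hb I2) as [r2 [H2 ->]].
    apply rotation_euler_potential in H1; [| assumption ..].
    apply rotation_euler_potential in H2; [| assumption ..].
    destruct (euler_potential_bounded _ _ HB I1) as [M1 HM1].
    destruct (euler_potential_bounded _ _ HB I2) as [M2 HM2].
    destruct (euler_potential_incr _ HB) as [kappa [Hk Hincr]].
    apply Rplus_le_compat_r.
    refine (rotation_le _ _ (Rmax M1 M2) _ _ _ _ _ _ _ H1 H2); intro t; cbv beta.
    + now apply euler_potential_continuous.
    + eapply Rle_trans; [apply HM1 | apply Rmax_l].
    + now apply euler_potential_continuous.
    + eapply Rle_trans; [apply HM2 | apply Rmax_r].
    + specialize (Hincr e1 e2 (cos t) He1 He12 He2 (COS_bound t)).
      assert (0 <= kappa * (e2 ^ 2 - e1 ^ 2)) by (apply Rmult_le_pos; nra). lra.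
  - intros beta e [Hb _] He.
    assert (HB : 0 < 7 * beta) by lra.
    assert (I0 : 0 <= 0 < 1) by lra. assert (I : 0 <= e < 1) by lra.
    destruct (euler_rotation_number_eq beta 0 Hb I0) as [r0 [H0 ->]].
    destruct (euler_rotation_number_eq beta e Hb I) as [r [H ->]].
    assert (E0 : r0 = sqrt (1 + 7 * beta)).
    { apply (rotation_unique (hill_coefficient beta 0) (1 + 7 * beta / (1 - 0)));
        [| | exact H0 |].
      - intro; now apply hill_coefficient_continuous.
      - intro; now apply hill_coefficient_bound.
      - apply rotation_const; [apply sqrt_lt_R0; lra |].
        intro t. rewrite pow2_sqrt by lra. unfold hill_coefficient. field. }
    split; [| lra].
    destruct (euler_potential_incr _ HB) as [kappa [Hk Hincr]].
    destruct (euler_potential_bounded _ _ HB I) as [M HM].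
    (* The gap is the same for all t, so the constant m^2 = 1 + 7 beta + d still lies below the
       transformed potential. Its rotation number m is explicit and exceeds sqrt(1 + 7 beta); a gap
       that depended on t would not give strictness by comparison alone. *)
    set (d := kappa * e ^ 2).
    assert (d0 : 0 < d) by (apply Rmult_lt_0_compat; [lra | apply pow_lt; lra]).
    set (m := sqrt (1 + 7 * beta + d)).
    assert (m2 : m ^ 2 = 1 + 7 * beta + d) by (apply pow2_sqrt; lra).
    assert (Hm : is_rotation (fun _ => m ^ 2) m)
      by (apply rotation_const; [apply sqrt_lt_R0; lra | reflexivity]).
    apply rotation_euler_potential in H; [| assumption ..].
    assert (mr : m <= r).
    { refine (rotation_le _ _ (Rmax M (m ^ 2)) _ _ _ _ _ _ _ Hm H); intro t; cbv beta.
      - apply continuous_const.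
      - rewrite Rabs_pos_eq by apply pow2_ge_0. apply Rmax_r.
      - now apply euler_potential_continuous.
      - eapply Rle_trans; [apply HM | apply Rmax_l].
      - specialize (Hincr 0 e (cos t) ltac:(lra) ltac:(lra) ltac:(lra) (COS_bound t)).
        rewrite euler_potential_0 in Hincr. rewrite m2. unfold d. lra. }
    assert (sqrt (1 + 7 * beta) < m) by (apply sqrt_lt_1; lra). lra.
Qed.
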